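(* Every strictly $DC2\frac12$ topological dynamical system $(X,f)$ has zero topological entropy.
   Context: A topological dynamical system $(X,f)$ consists of a non-empty compact metric space $(X,d)$ and a continuous map $f:X\to X$. For $(x_1,x_2)\in X^2$ and $\delta>0$ put $$\Phi_{(x_1,x_2)}(\delta)=\liminf_{m\to\infty}\frac1m\#\{0\le k\le m: d(f^k(x_1),f^k(x_2))<\delta\},$$ $$\Phi^*_{(x_1,x_2)}(\delta)=\limsup_{m\to\infty}\frac1m\#\{0\le k\le m: d(f^k(x_1),f^k(x_2))<\delta\}.$$ A pair $(x_1,x_2)$ is distributionally scrambled of type 2 (a DC2 pair) if $\Phi^*_{(x_1,x_2)}(\delta)=1$ for every $0<\delta\le\operatorname{diam}X$ and $\Phi_{(x_1,x_2)}(\epsilon)<1$ for some $0<\epsilon\le\operatorname{diam}X$. A pair $(x_1,x_2)$ is distributionally scrambled of type $2\frac12$ if there are positive numbers $c$ and $s$ such that $\Phi_{(x_1,x_2)}(\delta)<c<\Phi^*_{(x_1,x_2)}(\delta)$ for every $0<\delta<s$. The system $(X,f)$ is strictly $DC2\frac12$ if it possesses an uncountable set $S\subset X$ all of whose pairs of distinct points are distributionally scrambled of type $2\frac12$, but no DC2 pairs. *)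

(* Defs.v *)
From HB Require Import structures.
From mathcomp Require Import all_boot all_order all_algebra finmap.
From mathcomp Require Import all_classical all_reals all_analysis.

Set Implicit Arguments.
Unset Strict Implicit.
Unset Printing Implicit Defensive.

Import Order.TTheory GRing.Theory Num.Theory.
Import numFieldNormedType.Exports.

Local Open Scope classical_set_scope.
Local Open Scope ring_scope.

Section Dynamics.
Context {R : realType} {X : metricType R}.
Implicit Types (f : X -> X) (x y : X) (delta eps : R).

Definition tds f := [/\ [set: X] !=set0, compact [set: X] & continuous f].

Definition diam : R := sup [set mdist p.1 p.2 | p in [set: X * X]].

(* The number of k in {0, ..., m}, hence m + 1 times, divided by m.  The value
   at m = 0 is irrelevant, as only limits for m -> oo are taken. *)
Definition close_freq f x y delta (m : nat) : R :=
  m%:R^-1 *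
  #|[pred k : 'I_m.+1 | mdist (iter k f x) (iter k f y) < delta]|%:R.

Definition lower_distr f x y delta : \bar R :=
  limn_einf (fun m => (close_freq f x y delta m)%:E).

Definition upper_distr f x y delta : \bar R :=
  limn_esup (fun m => (close_freq f x y delta m)%:E).

Definition DC2_pair f x y :=
  (forall delta, 0 < delta <= diam -> upper_distr f x y delta = 1%E) /\
  (exists2 eps : R, 0 < eps <= diam & (lower_distr f x y eps < 1)%E).

Definition DC2half_pair f x y :=
  exists c s : R, [/\ 0 < c, 0 < s & forall delta, 0 < delta < s ->
    (lower_distr f x y delta < c%:E)%E /\ (c%:E < upper_distr f x y delta)%E].

Definition strictly_DC2half f :=
  (exists S : set X, ~ countable S /\
     forall x y, S x -> S y -> x <> y -> DC2half_pair f x y) /\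
  (forall x y, ~ DC2_pair f x y).

(* Topological entropy, by Bowen's definition with (n, eps)-separated sets. *)

Definition bowen_dist f (n : nat) x y : R :=
  \big[Num.max/0]_(k < n) mdist (iter k f x) (iter k f y).

Definition bowen_separated f (n : nat) eps (E : {fset X}) :=
  forall x y, x \in E -> y \in E -> x <> y -> eps < bowen_dist f n x y.

Definition max_separated f (n : nat) eps : \bar R :=
  ereal_sup [set (#|` E|%:R)%:E | E in bowen_separated f n eps].

Definition separated_growth f eps : \bar R :=
  limn_esup (fun n => (n%:R^-1)%:E * lne (max_separated f n eps))%E.

(* The limit exists in \bar R: separated_growth is nonincreasing in eps. *)
Definition topological_entropy f : \bar R :=
  lim (separated_growth f eps @[eps --> 0^'+]).

End Dynamics.

(* Main.v *)
(** Only the absence of DC2 pairs matters: positive entropy forces a DC2 pair.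

    Let [E_N] be (N, eps)-separated with [ln |E_N| >= N h] for infinitely many
    [N].  The entropy of a finite partition, averaged over the orbits of [E_N]
    up to time [N], converges along an ultrafilter to a functional [H] on all
    finite partitions that is monotone, submodular and invariant under [f].
    No measure on [X] is needed.  For a partition [P] of mesh at most [eps],
    [n] successive iterates have [H]-entropy at least [n h].

    Fix partitions [Q_0, Q_1, ...] with mesh tending to 0, each refining [P] and
    its predecessors.  Reading [Q_i] after time [m_i], for all [i], leaves
    almost all the entropy of the first [m_0] iterates of [P]: since the
    conditional entropy given the future equals the entropy rate, every
    refinement from [Q_i] to [Q_(i+1)] costs no more than it gains.  This gives
    alternating blocks of time: free blocks, and much longer blocks on which
    [Q_i] is observed, such that the [P]-names on the free blocks keep positive
    entropy rate given all the observations.  Pair each point [z] with a fixed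
    representative of its class of observations.  By Fano's inequality the two
    points lie in different cells of [P] for a positive proportion of each free
    block on average, and they are then really far apart, because the radii
    defining [P] are chosen so that orbits seldom visit a neighbourhood of the
    boundaries.  A reverse Fatou argument, followed by a limit of such pairs,
    yields two points that are close on all the observed blocks and far
    apart on a positive proportion of infinitely many free blocks. *)

Require Import Defs.
From mathcomp Require Import all_boot all_order all_algebra finmap.
From mathcomp Require Import all_classical all_reals all_analysis.
From mathcomp Require Import ring lra zify.

Set Implicit Arguments.
Unset Strict Implicit.
Unset Printing Implicit Defensive.

Import Order.TTheory GRing.Theory Num.Theory.
Import numFieldNormedType.Exports.

Local Open Scope classical_set_scope.
Local Open Scope ring_scope.

(** * Finite partitions as boolean relations, and their refinements along orbits *)

Section Partitions.
Context {X : Type}.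
Implicit Types (a b c e : rel X) (f g : X -> X).

(** A finite partition is encoded as the kernel of a map into a finite type. Relations make
    refinement plain [subrel], and identities between joins become extensional equalities. *)
Definition finite_part e :=
  exists (T : finType) (p : X -> T), forall x y, e x y = (p x == p y).

Definition rmeet a b : rel X := fun x y => a x y && b x y.

Definition pull g e : rel X := fun x y => e (g x) (g y).

Definition rtop : rel X := fun _ _ => true.

(** The join of the preimages of [e] under the iterates [s], ..., [s + n - 1]: its classes are the
    [e]-names over that stretch of time. *)
Definition window f e s n : rel X :=
  fun x y => all (fun k => e (iter k f x) (iter k f y)) (iota s n).

Lemma finite_part_refl e : finite_part e -> reflexive e.
Proof. by case=> T [p pE] x; rewrite pE. Qed.

Lemma finite_part_eql e x y : finite_part e -> e x y -> e x = e y.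
Proof.
by case=> T [p pE]; rewrite pE => /eqP pxy; apply/funext => z; rewrite !pE pxy.
Qed.

Lemma finite_part_sym e x y : finite_part e -> e x y = e y x.
Proof. by case=> T [p pE]; rewrite !pE eq_sym. Qed.

Lemma finite_part_ker (T : finType) (p : X -> T) :
  finite_part (fun x y => p x == p y).
Proof. by exists T, p. Qed.

Lemma finite_part_top : finite_part rtop.
Proof. by exists unit, (fun _ => tt). Qed.

Lemma finite_part_meet a b :
  finite_part a -> finite_part b -> finite_part (rmeet a b).
Proof.
move=> [T [p pE]] [U [q qE]].
by exists (T * U)%type, (fun x => (p x, q x)) => x y; rewrite /rmeet pE qE xpair_eqE.
Qed.

Lemma finite_part_pull g e : finite_part e -> finite_part (pull g e).
Proof. by move=> [T [p pE]]; exists T, (p \o g) => x y; rewrite /pull pE. Qed.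

Lemma window0 f e s : window f e s 0 = rtop.
Proof. by []. Qed.

Lemma window1 f e s : window f e s 1 = pull (iter s f) e.
Proof. by apply/funext => x; apply/funext => y; rewrite /window /= andbT. Qed.

Lemma window_add f e s n m :
  window f e s (n + m) = rmeet (window f e s n) (window f e (s + n) m).
Proof.
apply/funext => x; apply/funext => y.
by rewrite /rmeet /window iotaD all_cat.
Qed.

Lemma windowS f e s n :
  window f e s n.+1 = rmeet (pull (iter s f) e) (window f e s.+1 n).
Proof. by rewrite -add1n window_add window1 addn1. Qed.

Lemma finite_part_window f e s n : finite_part e -> finite_part (window f e s n).
Proof.
move=> fe; elim: n s => [|n IH] s; first by rewrite window0; exact: finite_part_top.
by rewrite windowS; apply: finite_part_meet => //; exact: finite_part_pull.
Qed.

Lemma pull_window f e k s n :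
  pull (iter k f) (window f e s n) = window f e (s + k) n.
Proof.
apply/funext => x; apply/funext => y; rewrite /pull /window addnC iotaDl all_map.
by apply: eq_all => i /=; rewrite -!iterD addnC.
Qed.

Lemma pull_meet g a b : pull g (rmeet a b) = rmeet (pull g a) (pull g b).
Proof. by []. Qed.

Lemma windowP f e s n x y :
  reflect (forall k, (s <= k < s + n)%N -> e (iter k f x) (iter k f y))
          (window f e s n x y).
Proof.
apply: (iffP allP) => h k.
  by move=> kn; apply: h; rewrite mem_iota.
by rewrite mem_iota; exact: h.
Qed.

Lemma rmeetA : associative rmeet.
Proof. by move=> a b c; apply/funext => x; apply/funext => y; rewrite /rmeet andbA. Qed.

Lemma rmeetC : commutative rmeet.
Proof. by move=> a b; apply/funext => x; apply/funext => y; rewrite /rmeet andbC. Qed.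

Lemma rmeetT a : rmeet a rtop = a.
Proof. by apply/funext => x; apply/funext => y; rewrite /rmeet andbT. Qed.

Lemma rmeet_absorb a b : subrel a b -> rmeet a b = a.
Proof.
move=> ab; apply/funext => x; apply/funext => y; rewrite /rmeet.
by apply/andb_idr/ab.
Qed.

Lemma rmeetS a b c e : subrel a c -> subrel b e -> subrel (rmeet a b) (rmeet c e).
Proof. by move=> ac be x y /andP[/ac xy /be xy']; apply/andP. Qed.

End Partitions.

(** * Shannon entropy of a finite sample *)

Section SampleEntropy.
Context {R : realType} {X : eqType}.
Implicit Types (a b c e : rel X) (E : seq X).

Definition avg E (g : X -> R) : R := (size E)%:R^-1 * \sum_(x <- E) g x.

Definition cnt E a x : R := (count (a x) E)%:R.

(* Shannon entropy of the [a]-classes for the uniform law on [E], counted with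
   multiplicities. *)
Definition ent E a : R := avg E (fun x => ln ((size E)%:R / cnt E a x)).

Lemma avg_le E (g h : X -> R) :
  (forall x, x \in E -> g x <= h x) -> avg E g <= avg E h.
Proof.
move=> gh; rewrite /avg ler_wpM2l// ?invr_ge0//.
by rewrite big_seq [leRHS]big_seq ler_sum.
Qed.

Lemma avg_ge0 E (g : X -> R) : (forall x, x \in E -> 0 <= g x) -> 0 <= avg E g.
Proof.
move=> g0; rewrite /avg mulr_ge0 ?invr_ge0// big_seq.
by apply: sumr_ge0.
Qed.

Lemma avgD E (g h : X -> R) : avg E (fun x => g x + h x) = avg E g + avg E h.
Proof. by rewrite /avg big_split/= mulrDr. Qed.

Lemma avgB E (g h : X -> R) : avg E (fun x => g x - h x) = avg E g - avg E h.
Proof. by rewrite /avg sumrB mulrBr. Qed.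

Lemma avgZ E (k : R) (g : X -> R) : avg E (fun x => k * g x) = k * avg E g.
Proof. by rewrite /avg -mulr_sumr mulrCA. Qed.

Lemma avg_cst E (k : R) : (0 < size E)%N -> avg E (fun=> k) = k.
Proof.
move=> E0; rewrite /avg big_const_seq count_predT iter_addr_0 -[k *+ _]mulr_natl.
by rewrite mulKf// pnatr_eq0 -lt0n.
Qed.

Lemma avg_sum E n (g : nat -> X -> R) :
  avg E (fun x => \sum_(i < n) g i x) = \sum_(i < n) avg E (g i).
Proof. by rewrite /avg exchange_big/= mulr_sumr. Qed.

Lemma eq_avg E (g h : X -> R) : (forall x, x \in E -> g x = h x) -> avg E g = avg E h.
Proof.
by move=> gh; rewrite /avg big_seq [in RHS]big_seq; congr (_ * _); apply: eq_bigr.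
Qed.

Lemma cntE E a x : cnt E a x = \sum_(y <- E) (a x y)%:R.
Proof. by rewrite /cnt -sum1_count natr_sum big_mkcond/=; apply: eq_bigr => y _; case: (a x y). Qed.

Lemma cnt_ge0 E a x : 0 <= cnt E a x.
Proof. by rewrite /cnt. Qed.

Lemma cnt_gt0 E a x : reflexive a -> x \in E -> 0 < cnt E a x.
Proof. by move=> ra xE; rewrite /cnt ltr0n -has_count; apply/hasP; exists x. Qed.

Lemma cnt_le E a b x : subrel a b -> cnt E a x <= cnt E b x.
Proof. by move=> ab; rewrite /cnt ler_nat; apply: sub_count => y; exact: ab. Qed.

Lemma cnt_le_size E a x : cnt E a x <= (size E)%:R.
Proof. by rewrite /cnt ler_nat count_size. Qed.

Lemma size_gt0_mem E (x : X) : x \in E -> (0 : R) < (size E)%:R.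
Proof. by rewrite ltr0n; case: E. Qed.

Lemma ent_ge0 E a : reflexive a -> 0 <= ent E a.
Proof.
move=> ra; apply: avg_ge0 => x xE.
by rewrite ln_ge0// ler_pdivlMr ?cnt_gt0// mul1r cnt_le_size.
Qed.

Lemma ent_top E : ent E rtop = 0.
Proof.
rewrite /ent (@eq_avg _ _ (fun=> 0)).
  by rewrite /avg big1 ?mulr0.
move=> x xE; rewrite /cnt count_predT divff ?ln1//.
by rewrite gt_eqF// (size_gt0_mem xE).
Qed.

Lemma ent_mono E a b : reflexive a -> subrel a b -> ent E b <= ent E a.
Proof.
move=> ra ab; apply: avg_le => x xE.
have a0 : 0 < cnt E a x by exact: cnt_gt0.
have b0 : 0 < cnt E b x by exact: lt_le_trans a0 (cnt_le _ _ ab).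
have S0 := size_gt0_mem xE.
rewrite ler_ln ?posrE ?divr_gt0// ler_pM2l// lef_pV2 ?posrE//.
exact: cnt_le.
Qed.

(** [S] lies in a single class of [b], so the nonzero terms share one denominator, the number of
    entries of [E] in that class, and there are at most that many of them. *)
Lemma sum_inv_cnt_le1 E b (S : pred X) : finite_part b ->
  (forall x y, S x -> S y -> b x y) ->
  \sum_(x <- E) (S x)%:R / cnt E b x <= 1.
Proof.
move=> fb Sb; have [/hasP[x0 x0E Sx0]|/hasPn nS] := boolP (has S E); last first.
  by rewrite big_seq big1// => x /nS /negbTE ->; rewrite mul0r.
have c0 : 0 < cnt E b x0 by exact: cnt_gt0 (finite_part_refl fb) x0E.
rewrite (eq_bigr (fun x => (S x)%:R / cnt E b x0)); last first.
  move=> x _; have [Sx|] := boolP (S x); last by rewrite !mul0r.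
  by rewrite /cnt (finite_part_eql fb (Sb _ _ Sx Sx0)).
rewrite -mulr_suml ler_pdivrMr// mul1r cntE ler_sum// => x _.
by rewrite ler_nat; case: (boolP (S x)) => // Sx; rewrite Sb.
Qed.

(* Gibbs' inequality, with the conditional entropy given [a] as cross entropy:
   [W x] plays the role of a guess of the value of [p] from the [a]-class. *)
Lemma ent_gibbs E a (T : finType) (p : X -> T) (W : X -> T -> R) :
  finite_part a ->
  (forall x v, 0 <= W x v) -> (forall x, x \in E -> 0 < W x (p x)) ->
  (forall x y, a x y -> W x = W y) ->
  (forall x, x \in E -> \sum_v W x v <= 1) ->
  ent E (rmeet a (fun x y => p x == p y)) - ent E a <=
    avg E (fun x => - ln (W x (p x))).
Proof.
move=> fa W0 Wp Wa W1; set m := rmeet a _.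
have fm : finite_part m by apply: finite_part_meet => //; exact: finite_part_ker.
have ra := finite_part_refl fa; have rm := finite_part_refl fm.
rewrite -subr_le0 -!avgB.
(* By [ln z <= z - 1] it suffices to bound this likelihood ratio. Expanding [cnt E a x] over [y] and
   exchanging the sums leaves, for each [y], at most the total mass of [W y]. *)
have h1 : avg E (fun x => W x (p x) * cnt E a x / cnt E m x - 1) <= 0.
  rewrite /avg mulr_ge0_le0 ?invr_ge0// sumrB subr_le0.
  rewrite (_ : \sum_(x <- E) 1 = \sum_(y <- E) 1 :> R)//.
  under eq_bigr => x _ do rewrite cntE mulr_sumr mulr_suml.
  rewrite exchange_big/= big_seq [leRHS]big_seq ler_sum// => y yE.
  apply: le_trans (W1 _ yE).
  (* [W x] is replaced by [W y] inside the [a]-class of [y], and the points are sorted by [v = p x];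
     for fixed [v] they lie in one class of [m]. *)
  rewrite (eq_bigr (fun x => \sum_v W y v * ((a y x && (p x == v))%:R / cnt E m x))).
    rewrite exchange_big/=; apply: ler_sum => v _.
    rewrite -mulr_sumr -[leRHS]mulr1 ler_wpM2l// (@sum_inv_cnt_le1 E m (fun x => a y x && (p x == v)))//.
    move=> x x' /andP[ax /eqP px] /andP[ax' /eqP px'].
    by rewrite /m /rmeet px px' eqxx andbT -(finite_part_eql fa ax).
  move=> x _; rewrite (bigD1 (p x))//= big1 ?addr0; last first.
    by move=> v /negbTE; rewrite eq_sym => ->; rewrite andbF mul0r mulr0.
  rewrite eqxx andbT (finite_part_sym x y fa) -mulrA.
  by have [/Wa ->//|] := boolP (a y x); rewrite !mul0r !mulr0.
apply: le_trans h1; apply: avg_le => x xE.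
have a0 : 0 < cnt E a x by exact: cnt_gt0.
have m0 : 0 < cnt E m x by exact: cnt_gt0.
have S0 := size_gt0_mem xE; have w0 := Wp _ xE.
rewrite !ln_div ?posrE// opprK.
have -> : forall s u v w : R, s - u - (s - v) + w = (w + v) - u by move=> *; ring.
rewrite -lnM ?posrE// -ln_div ?posrE ?mulr_gt0//.
set z := _ / _; have z0 : 0 < z by rewrite divr_gt0 ?mulr_gt0.
have := @le_ln1Dx R (z - 1); rewrite [1 + _]addrC subrK; apply.
by rewrite ltrBrDl addrN.
Qed.

Lemma ent_le_card E (T : finType) (p : X -> T) a : finite_part a ->
  ent E (rmeet a (fun x y => p x == p y)) - ent E a <= ln #|T|%:R.
Proof.
move=> fa; have [->|E0] := eqVneq E [::].
  rewrite /ent /avg !big_nil !mulr0 subrr.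
  have [->|] := eqVneq #|T| 0%N; first by rewrite ln0.
  by rewrite -lt0n => T0; rewrite ln_ge0// ler1n.
have [x0 x0E] : exists x, x \in E.
  by case: E E0 => // x E _; exists x; rewrite mem_head.
have T0 : (0 : R) < #|T|%:R by rewrite ltr0n; apply/card_gt0P; exists (p x0).
apply: le_trans (@ent_gibbs E a T p (fun _ _ => #|T|%:R^-1) fa _ _ _ _) _ => //.
- by move=> _ _; rewrite invr_gt0.
- by move=> _ _; rewrite sumr_const -[X in X <= _]mulr_natl divff// gt_eqF.
- rewrite lnV ?posrE// opprK avg_cst// lt0n; by case: (E) E0.
Qed.

(** Gibbs' inequality given [b] and [c], where the guess is the empirical law of [a] in the
    [c]-class: its logarithmic loss is the conditional entropy of [a] given [c]. *)
Lemma ent_submod E a b c : finite_part a -> finite_part b -> finite_part c ->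
  ent E (rmeet (rmeet b c) a) + ent E c <= ent E (rmeet a c) + ent E (rmeet b c).
Proof.
move=> [T [p pE]] fb fc.
have -> : a = (fun x y => p x == p y) by apply/funext => x; apply/funext => y.
pose W x v : R := if cnt E c x == 0 then 0 else
  (\sum_(y <- E) (c x y && (p y == v))%:R) / cnt E c x.
have fbc := finite_part_meet fb fc.
have fm : finite_part (rmeet (fun x y => p x == p y) c).
  by apply: finite_part_meet => //; exact: finite_part_ker.
have WE x : x \in E -> W x (p x) = cnt E (rmeet (fun x y => p x == p y) c) x / cnt E c x.
  move=> xE; rewrite /W ifF; last by rewrite gt_eqF// cnt_gt0//; exact: finite_part_refl.
  congr (_ / _); under eq_bigr do rewrite eq_sym andbC.
  by rewrite cntE.
have := @ent_gibbs E _ T p W fbc.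
have W0 : forall x v, 0 <= W x v.
  move=> x v; rewrite /W; case: ifP => // _.
  by rewrite divr_ge0 ?cnt_ge0// sumr_ge0// => ? _.
have Wp : forall x, x \in E -> 0 < W x (p x).
  move=> x xE; rewrite WE// divr_gt0// cnt_gt0//; exact: finite_part_refl.
have Wc : forall x y, rmeet b c x y -> W x = W y.
  move=> x y /andP[_ cxy]; apply/funext => v; rewrite /W /cnt.
  by rewrite (finite_part_eql fc cxy).
have W1 : forall x, x \in E -> \sum_v W x v <= 1.
  move=> x xE.
  have c0 : cnt E c x == 0 = false.
    by rewrite gt_eqF// cnt_gt0//; exact: finite_part_refl.
  under eq_bigr do rewrite /W c0.
  rewrite -mulr_suml exchange_big/= ler_pdivrMr ?mul1r ?cnt_gt0//; last exact: finite_part_refl.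
  rewrite cntE ler_sum// => y _; rewrite (bigD1 (p y))//= big1.
    by rewrite eqxx andbT addr0.
  by move=> v /negbTE; rewrite eq_sym => ->; rewrite andbF.
move=> /(_ W0 Wp Wc W1) h.
set A := avg E _ in h.
suff : A <= ent E (rmeet (fun x y => p x == p y) c) - ent E c by move: h; lra.
rewrite /A /ent -avgB; apply: avg_le => x xE; rewrite WE//.
have S0 := size_gt0_mem xE.
have c0 : 0 < cnt E c x by apply: cnt_gt0 => //; exact: finite_part_refl.
have m0 : 0 < cnt E (rmeet (fun x y => p x == p y) c) x.
  by apply: cnt_gt0 => //; exact: finite_part_refl.
rewrite !ln_div ?posrE//; lra.
Qed.

Lemma ent_map E (g : X -> X) a : ent [seq g x | x <- E] a = ent E (pull g a).
Proof.
rewrite /ent /avg size_map big_map; congr (_ * _); apply: eq_bigr => x _.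
by rewrite /cnt count_map.
Qed.

Lemma avg_map E (g : X -> X) (F : X -> R) : avg [seq g x | x <- E] F = avg E (F \o g).
Proof. by rewrite /avg size_map big_map. Qed.

(* Fano's inequality, weakened to an affine function of the error rate so that
   it can be averaged over samples. *)
Lemma ent_fano E a (T : finType) (p : X -> T) (r : X -> X) (u : R) :
  (0 < size E)%N -> finite_part a -> (forall x y, a x y -> r x = r y) -> 0 < u < 1 ->
  ent E (rmeet (fun x y => p x == p y) a) - ent E a <=
    - ln (1 - u) + ln (#|T|%:R / u) * avg E (fun x => (p x != p (r x))%:R).
Proof.
move=> E0 fa ra /andP[u0 u1].
have [x0 _] : exists x, x \in E by case: (E) E0 => // x s _; exists x; exact: mem_head.
have T1 : (1 : R) <= #|T|%:R by rewrite ler1n; apply/card_gt0P; exists (p x0).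
have T0 : (0 : R) < #|T|%:R by exact: lt_le_trans T1.
have v0 : 0 < 1 - u by rewrite subr_gt0.
(* The predicted cell receives most of the mass, and the remainder is spread so that an error costs
   a bounded loss, [ln (#|T| / u)]. *)
pose W x v : R := if v == p (r x) then 1 - u else u / #|T|%:R.
rewrite rmeetC; apply: le_trans (@ent_gibbs E a T p W fa _ _ _ _) _.
- by move=> x v; rewrite /W; case: ifP => _; rewrite ltW// divr_gt0.
- by move=> x _; rewrite /W; case: ifP => _//; rewrite divr_gt0.
- by move=> x y xy; rewrite /W (ra _ _ xy).
- move=> x _; rewrite (bigD1 (p (r x)))//= /W eqxx.
  rewrite (eq_bigr (fun=> u / #|T|%:R)); last by move=> v /negbTE ->.
  rewrite sumr_const -[_ *+ _]mulr_natr addrC -lerBrDr opprB addrCA subrr addr0.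
  rewrite -[leRHS]mulr1 -mulrA ler_wpM2l ?(ltW u0)// mulrC ler_pdivrMr// mul1r.
  by rewrite ler_nat max_card.
rewrite -avgZ -[X in X + _](@avg_cst E _ E0) -avgD; apply: avg_le => x _.
have l1 : 0 <= - ln (1 - u) by rewrite oppr_ge0 ln_le0// gerBl ltW.
rewrite /W; case: eqP => _ /=; first by rewrite mulr0 addr0.
by rewrite mulr1 -lnV ?posrE ?divr_gt0// invf_div lerDr.
Qed.

End SampleEntropy.

(** * Limits along an ultrafilter *)

Section Ultralimit.
Context {R : realType} {U : set_system nat}.

(** Compactness gives a cluster point, and a cluster point of an ultrafilter is a limit. *)
Lemma ultra_cvg_compact {UU : UltraFilter U} (T : topologicalType) (u : nat -> T) (K : set T) :
  compact K -> (forall n, K (u n)) -> exists2 p, K p & u @ U --> p.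
Proof.
move=> cK uK; have [p [Kp clp]] : K `&` cluster (u @ U) !=set0.
  by apply: cK; rewrite /nbhs/=; apply: filterS filterT => n _; exact: uK.
exists p => // A nA.
have [//|UA] := in_ultra_setVsetC (u @^-1` A) UU.
have [q [/= nAq Aq]] : (~` A) `&` A !=set0 by apply: clp.
by [].
Qed.

Definition bounded_seq (u : nat -> R) := exists B : R, forall n, `|u n| <= B.

Definition ulim (u : nat -> R) : R := lim (u @ U).

Lemma bounded_seq_cst c : bounded_seq (fun=> c).
Proof. by exists `|c|. Qed.

Lemma bounded_seqD u v :
  bounded_seq u -> bounded_seq v -> bounded_seq (fun n => u n + v n).
Proof.
move=> [B uB] [C vC]; exists (B + C) => n.
by rewrite (le_trans (ler_normD _ _))// lerD.
Qed.

Lemma bounded_seqN u : bounded_seq u -> bounded_seq (fun n => - u n).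
Proof. by move=> [B uB]; exists B => n; rewrite normrN. Qed.

Lemma bounded_seq_sum (u : nat -> nat -> R) m :
  (forall k, bounded_seq (u k)) -> bounded_seq (fun n => \sum_(k < m) u k n).
Proof.
move=> bu; elim: m => [|m IH].
  by exists 0 => n; rewrite big_ord0 normr0.
under eq_fun do rewrite big_ord_recr.
exact: bounded_seqD.
Qed.

Context {UU : UltraFilter U}.

Lemma ulim_cvg u : bounded_seq u -> u @ U --> ulim u.
Proof.
move=> [B uB].
have [|p _ up] := @ultra_cvg_compact UU _ u _ (@segment_compact R (- B) B).
  by move=> n; rewrite /= in_itv/= -ler_norml.
by rewrite /ulim (cvg_lim _ up).
Qed.

Lemma ulim_eq u l : u @ U --> l -> ulim u = l.
Proof. by move=> ul; rewrite /ulim (cvg_lim _ ul). Qed.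

Lemma ulim_cst c : ulim (fun=> c) = c.
Proof. by apply: ulim_eq; exact: cvg_cst. Qed.

Lemma ulimD u v : bounded_seq u -> bounded_seq v ->
  ulim (fun n => u n + v n) = ulim u + ulim v.
Proof. by move=> bu bv; apply: ulim_eq; apply: cvgD; exact: ulim_cvg. Qed.

Lemma ulimN u : bounded_seq u -> ulim (fun n => - u n) = - ulim u.
Proof. by move=> bu; apply: ulim_eq; apply: cvgN; exact: ulim_cvg. Qed.

Lemma ulimB u v : bounded_seq u -> bounded_seq v ->
  ulim (fun n => u n - v n) = ulim u - ulim v.
Proof. by move=> bu bv; rewrite ulimD ?ulimN//; exact: bounded_seqN. Qed.

Lemma ulim_sum (u : nat -> nat -> R) m :
  (forall k, bounded_seq (u k)) ->
  ulim (fun n => \sum_(k < m) u k n) = \sum_(k < m) ulim (u k).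
Proof.
move=> bu; elim: m => [|m IH].
  under eq_fun do rewrite big_ord0.
  by rewrite big_ord0 ulim_cst.
under eq_fun do rewrite big_ord_recr.
by rewrite ulimD ?IH ?big_ord_recr//; exact: bounded_seq_sum.
Qed.

Lemma ulim_le u v : bounded_seq u -> bounded_seq v ->
  U [set n | u n <= v n] -> ulim u <= ulim v.
Proof.
by move=> /ulim_cvg cu /ulim_cvg cv uv; apply: (ler_cvg_to cu cv).
Qed.

Lemma ulim_gt u c : bounded_seq u -> c < ulim u -> U [set n | c < u n].
Proof. by move=> /ulim_cvg cu; exact: (cvgr_gt _ cu). Qed.

Lemma ulim_lt u c : bounded_seq u -> ulim u < c -> U [set n | u n < c].
Proof. by move=> /ulim_cvg cu; exact: (cvgr_lt _ cu). Qed.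

(** Since [U] refines the filter at infinity, an error that vanishes at infinity disappears;
    approximate invariance under time shifts becomes exact. *)
Lemma ulim_norm_le (u v w : nat -> R) : \oo `<=` U ->
  bounded_seq u -> bounded_seq v -> w @ \oo --> (0 : R) ->
  (forall n, `|u n - v n| <= w n) -> ulim u = ulim v.
Proof.
move=> ooU bu bv w0 uvw.
have : (fun n => u n - v n) @ \oo --> (0 : R).
  apply/cvgr0Pnorm_lt => e e0; near=> n.
  apply: le_lt_trans (uvw n) _; apply: le_lt_trans (ler_norm _) _.
  by near: n; move/cvgr0Pnorm_lt : w0; apply.
move=> h; apply/eqP; rewrite -subr_eq0 -ulimB//; apply/eqP/ulim_eq.
by move=> A /h; exact: ooU.
Unshelve. all: by end_near. Qed.

End Ultralimit.
Arguments ulim {R} U u.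

(** * Entropy averaged along orbits *)

Section OrbitAverage.
Context {R : realType} {X : eqType} (f : X -> X).
Context (E : nat -> seq X) (N : nat -> nat).
Hypothesis E_gt0 : forall i, (0 < size (E i))%N.
Hypothesis N_gt : forall i, (i < N i)%N.
Implicit Types (a b c e : rel X) (g : X -> R).

Definition orbit_avg i g : R :=
  (N i)%:R^-1 * \sum_(t < N i) avg (E i) (g \o iter t f).

(** The entropies, rather than the laws, are averaged over time, so that inequalities for one sample
    pass to the average term by term. *)
Definition orbit_ent i a : R :=
  (N i)%:R^-1 * \sum_(t < N i) ent (E i) (pull (iter t f) a).

Let N_gt0 i : (0 : R) < (N i)%:R.
Proof. by rewrite ltr0n (leq_ltn_trans _ (N_gt i)). Qed.

Lemma time_avg_le i (u v : 'I_(N i) -> R) : (forall t, u t <= v t) ->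
  (N i)%:R^-1 * \sum_(t < N i) u t <= (N i)%:R^-1 * \sum_(t < N i) v t.
Proof. by move=> uv; rewrite ler_wpM2l ?invr_ge0// ler_sum. Qed.

Lemma time_avg_cst i (c : R) : (N i)%:R^-1 * \sum_(t < N i) c = c :> R.
Proof.
by rewrite sumr_const card_ord -[c *+ _]mulr_natl mulKf// gt_eqF.
Qed.

(** The difference telescopes to two boundary terms divided by [N i], which is at least [i + 1]. *)
Lemma time_avg_shift i (u : nat -> R) B : (forall t, 0 <= u t <= B) ->
  `|(N i)%:R^-1 * \sum_(t < N i) u t.+1 - (N i)%:R^-1 * \sum_(t < N i) u t| <=
  B * harmonic i.
Proof.
move=> uB; rewrite -mulrBr -sumrB.
have -> : \sum_(t < N i) (u t.+1 - u t) = u (N i) - u 0%N.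
  by rewrite -(big_mkord xpredT (fun t => u t.+1 - u t)) telescope_sumr.
rewrite normrM ger0_norm ?invr_ge0// mulrC; apply: ler_pM => //.
  have := uB 0%N; have := uB (N i); rewrite ler_norml; lra.
by rewrite lef_pV2 ?posrE// ler_nat.
Qed.

Lemma orbit_avg_le i g h : (forall x, g x <= h x) -> orbit_avg i g <= orbit_avg i h.
Proof. by move=> gh; apply: time_avg_le => t; apply: avg_le => x _ /=. Qed.

Lemma orbit_avgD i g h : orbit_avg i (fun x => g x + h x) = orbit_avg i g + orbit_avg i h.
Proof.
rewrite /orbit_avg -mulrDr -big_split/=; congr (_ * _).
by apply: eq_bigr => t _; rewrite -avgD.
Qed.

Lemma orbit_avgZ i k g : orbit_avg i (fun x => k * g x) = k * orbit_avg i g.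
Proof.
rewrite /orbit_avg mulrCA; congr (_ * _); rewrite mulr_sumr.
by apply: eq_bigr => t _; rewrite -avgZ.
Qed.

Lemma orbit_avg_cst i (c : R) : orbit_avg i (fun=> c) = c.
Proof.
rewrite /orbit_avg -[RHS](time_avg_cst i); congr (_ * _).
by apply: eq_bigr => t _; rewrite /comp avg_cst.
Qed.

Lemma orbit_avg_sum i n (g : nat -> X -> R) :
  orbit_avg i (fun x => \sum_(k < n) g k x) = \sum_(k < n) orbit_avg i (g k).
Proof.
rewrite /orbit_avg -[RHS]mulr_sumr; congr (_ * _); rewrite exchange_big/=.
by apply: eq_bigr => t _; rewrite -(@avg_sum R X (E i) n (fun k => g k \o iter t f)).
Qed.

Lemma orbit_avg_exists i g (c : R) : c < orbit_avg i g -> exists x, c < g x.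
Proof.
move=> cg; apply/not_existsP => h; move: cg; apply/negP; rewrite -leNgt.
rewrite -[leRHS](orbit_avg_cst i); apply: orbit_avg_le => x.
by rewrite leNgt; apply/negP/h.
Qed.

Lemma orbit_avg_ge0 i g : (forall x, 0 <= g x) -> 0 <= orbit_avg i g.
Proof. by move=> g0; rewrite -(orbit_avg_cst i 0); exact: orbit_avg_le. Qed.

Lemma orbit_ent_bounded a : finite_part a -> bounded_seq (orbit_ent^~ a).
Proof.
move=> fa; have [T [p pE]] := fa.
have aE t : pull (iter t f) a = (fun x y => (p \o iter t f) x == (p \o iter t f) y).
  by apply/funext => x; apply/funext => y; rewrite /pull pE.
exists (ln #|T|%:R) => i; rewrite ger0_norm.
  rewrite -[leRHS](time_avg_cst i); apply: time_avg_le => t.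
  have := @ent_le_card R _ (E i) T (p \o iter t f) rtop finite_part_top.
  by rewrite ent_top subr0 rmeetC rmeetT aE.
rewrite -(time_avg_cst i 0); apply: time_avg_le => t.
by apply: ent_ge0; apply: finite_part_refl; exact: finite_part_pull.
Qed.

Lemma orbit_avg_bounded g : (exists B, forall x, 0 <= g x <= B) ->
  bounded_seq (orbit_avg^~ g).
Proof.
move=> [B gB]; exists B => i; rewrite ger0_norm.
  by rewrite -[leRHS](orbit_avg_cst i); apply: orbit_avg_le => x; have /andP[] := gB x.
by apply: orbit_avg_ge0 => x; have /andP[] := gB x.
Qed.

Context {U : set_system nat} {UU : UltraFilter U}.
Hypothesis ooU : \oo `<=` U.

Definition mean_ent a : R := ulim U (orbit_ent^~ a).

Definition mean_avg g : R := ulim U (orbit_avg^~ g).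

Lemma mean_ent_mono a b : finite_part a -> finite_part b -> subrel a b ->
  mean_ent b <= mean_ent a.
Proof.
move=> fa fb ab; apply: ulim_le; try exact: orbit_ent_bounded.
apply: filterS filterT => i _ /=; apply: time_avg_le => t.
apply: ent_mono; first by apply: finite_part_refl; exact: finite_part_pull.
by move=> x y; exact: ab.
Qed.

Lemma mean_ent_submod a b c : finite_part a -> finite_part b -> finite_part c ->
  mean_ent (rmeet (rmeet b c) a) + mean_ent c <=
  mean_ent (rmeet a c) + mean_ent (rmeet b c).
Proof.
move=> fa fb fc; have fac := finite_part_meet fa fc.
have fbc := finite_part_meet fb fc; have fbca := finite_part_meet fbc fa.
rewrite /mean_ent -!ulimD; try exact: orbit_ent_bounded.
apply: ulim_le; try by apply: bounded_seqD; exact: orbit_ent_bounded.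
apply: filterS filterT => i _ /=; rewrite /orbit_ent -!mulrDr -!big_split/=.
apply: (@time_avg_le i
  (fun t => ent (E i) (pull (iter t f) (rmeet (rmeet b c) a)) +
            ent (E i) (pull (iter t f) c))
  (fun t => ent (E i) (pull (iter t f) (rmeet a c)) +
            ent (E i) (pull (iter t f) (rmeet b c)))) => t.
by rewrite !pull_meet; apply: ent_submod; exact: finite_part_pull.
Qed.

Lemma mean_ent_top : mean_ent rtop = 0.
Proof.
rewrite /mean_ent (_ : orbit_ent^~ rtop = (fun=> 0)) ?ulim_cst//.
apply/funext => i; rewrite /orbit_ent big1 ?mulr0// => t _.
exact: (@ent_top R X (E i)).
Qed.

Lemma harmonic_scale_cvg0 (B : R) : (fun i => B * harmonic i) @ \oo --> (0 : R).
Proof. by rewrite -(mulr0 B); apply: cvgMl_tmp; exact: cvg_harmonic. Qed.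

Lemma mean_ent_pull a : finite_part a -> mean_ent (pull f a) = mean_ent a.
Proof.
move=> fa; have [T [p pE]] := fa.
have aE t : pull (iter t f) a = (fun x y => (p \o iter t f) x == (p \o iter t f) y).
  by apply/funext => x; apply/funext => y; rewrite /pull pE.
apply: (@ulim_norm_le _ _ _ _ _ (fun i => ln #|T|%:R * harmonic i)) => //.
- by apply: orbit_ent_bounded; exact: finite_part_pull.
- exact: orbit_ent_bounded.
- exact: harmonic_scale_cvg0.
move=> i; apply: (@time_avg_shift i (fun t => ent (E i) (pull (iter t f) a))) => t.
rewrite ent_ge0/=; last by apply: finite_part_refl; exact: finite_part_pull.
have := @ent_le_card R _ (E i) T (p \o iter t f) rtop finite_part_top.
by rewrite ent_top subr0 rmeetC rmeetT aE.
Qed.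

Lemma mean_avg_pull g B : (forall x, 0 <= g x <= B) ->
  mean_avg (g \o f) = mean_avg g.
Proof.
move=> gB.
apply: (@ulim_norm_le _ _ _ _ _ (fun i => B * harmonic i)) => //.
- by apply: orbit_avg_bounded; exists B => x; exact: gB.
- by apply: orbit_avg_bounded; exists B.
- exact: harmonic_scale_cvg0.
move=> i; apply: (@time_avg_shift i (fun t => avg (E i) (g \o iter t f))) => t.
rewrite -[X in _ <= _ <= X](@avg_cst _ _ (E i))//.
by apply/andP; split; [apply: avg_ge0|apply: avg_le] => x _; have /andP[] := gB (iter t f x).
Qed.

End OrbitAverage.
Arguments mean_ent {R X} f E N U a.
Arguments mean_avg {R X} f E N U g.

(** * Conditional entropy along a sparse schedule *)

Section WindowFamilies.
Context {X : Type} (f : X -> X) (Q : nat -> rel X) (s m : nat -> nat).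
Hypothesis Qfin : forall j, finite_part (Q j).

Lemma finite_part_all (F : nat -> rel X) (r : seq nat) :
  (forall i, finite_part (F i)) -> finite_part (fun x y => all (fun i => F i x y) r).
Proof.
move=> fF; elim: r => [|i r IH]; first exact: finite_part_top.
exact: (finite_part_meet (fF i) IH).
Qed.

(** With time counted from the start of the free block [j], this refines everything [agree] observes
    from then on, up to rank [K] and time [L]. Each [Q i] is watched without interruption from
    [m i], which suits an induction on [j]. *)
Definition later K j L : rel X := fun x y =>
  all (fun i => window f (Q i) (m i) (L - m i) x y) (iota j (K.+1 - j)).

Lemma laterP K j L x y :
  reflect (forall i t, (j <= i <= K)%N -> (m i <= t < L)%N ->
             Q i (iter t f x) (iter t f y)) (later K j L x y).
Proof.
apply: (iffP allP) => [h i t ij tL|h i].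
  have /windowP : window f (Q i) (m i) (L - m i) x y by apply: h; rewrite mem_iota; lia.
  by apply; lia.
by rewrite mem_iota => ij; apply/windowP => t tL; apply: h; lia.
Qed.

Lemma finite_part_later K j L : finite_part (later K j L).
Proof. by apply: finite_part_all => i; exact: finite_part_window. Qed.

(* [Q j] is observed on the block [s j + m j, s j.+1), for each j < n; the
   blocks [s j, s j + m j) are left free. *)
Definition agree n : rel X := fun x y =>
  all (fun j => window f (Q j) (s j + m j) (s j.+1 - (s j + m j)) x y) (iota 0 n).

Lemma agreeP n x y :
  reflect (forall j t, (j < n)%N -> (s j + m j <= t < s j.+1)%N ->
             Q j (iter t f x) (iter t f y)) (agree n x y).
Proof.
apply: (iffP allP) => [h j t jn tL|h j].
  have /windowP : window f (Q j) (s j + m j) (s j.+1 - (s j + m j)) x y.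
    by apply: h; rewrite mem_iota; lia.
  by apply; lia.
by rewrite mem_iota => jn; apply/windowP => t tL; apply: h; lia.
Qed.

Lemma finite_part_agree n : finite_part (agree n).
Proof. by apply: finite_part_all => i; exact: finite_part_window. Qed.

End WindowFamilies.

(** * Chain rule, entropy rates and conditioning for an abstract invariant submodular functional *)

Section EntropyFunctional.
Context {R : realType} {X : Type} (f : X -> X) (H : rel X -> R).
Hypothesis H_mono : forall a b, finite_part a -> finite_part b ->
  subrel a b -> H b <= H a.
Hypothesis H_submod : forall a b c,
  finite_part a -> finite_part b -> finite_part c ->
  H (rmeet (rmeet b c) a) + H c <= H (rmeet a c) + H (rmeet b c).
Hypothesis H_top : H rtop = 0.
Hypothesis H_pull : forall a, finite_part a -> H (pull f a) = H a.
Implicit Types (a b c d e : rel X).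

(** The conditional entropy [H(a | c)]. *)
Definition cond a c : R := H (rmeet a c) - H c.

Lemma H_ge0 a : finite_part a -> 0 <= H a.
Proof. by move=> fa; rewrite -H_top; apply: H_mono => //; exact: finite_part_top. Qed.

Lemma cond_meet a b c : finite_part a -> finite_part b -> finite_part c ->
  cond a (rmeet b c) <= cond a c.
Proof.
by move=> fa fb fc; rewrite /cond; have := H_submod fa fb fc; rewrite (rmeetC a (rmeet b c)); lra.
Qed.

Lemma cond_anti a c d : finite_part a -> finite_part c -> finite_part d ->
  subrel d c -> cond a d <= cond a c.
Proof. by move=> fa fc fd dc; rewrite -(rmeet_absorb dc); exact: cond_meet. Qed.

Lemma cond_chain a b c : cond (rmeet a b) c = cond b c + cond a (rmeet b c).
Proof. by rewrite /cond rmeetA; ring. Qed.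

Lemma iter_pull k a : finite_part a -> H (pull (iter k f) a) = H a.
Proof.
elim: k a => [|k IH] a fa; first by congr H.
by rewrite -[RHS]H_pull// -[RHS]IH//; exact: finite_part_pull.
Qed.

Lemma cond_pull k a c : finite_part a -> finite_part c ->
  cond (pull (iter k f) a) (pull (iter k f) c) = cond a c.
Proof.
by move=> fa fc; rewrite /cond -pull_meet !iter_pull//; exact: finite_part_meet.
Qed.

(** As [a] refines [b], the left side is [H(a | b, c)] and the right side is [H(a | b)]. *)
Lemma cond_diff a b c : finite_part a -> finite_part b -> finite_part c ->
  subrel a b -> cond a c - cond b c <= H a - H b.
Proof.
move=> fa fb fc ab; have := H_submod fa fc fb.
rewrite (rmeet_absorb ab) -rmeetA (rmeetC b a) (rmeet_absorb ab).
by rewrite /cond (rmeetC c a) (rmeetC c b); lra.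
Qed.

Lemma cond_window_le e a s n : finite_part e -> finite_part a ->
  cond (window f e s n) a <= \sum_(k < n) cond (pull (iter (s + k) f) e) a.
Proof.
move=> fe fa; elim: n s => [|n IH] s.
  by rewrite big_ord0 window0 /cond rmeetC rmeetT subrr.
rewrite windowS cond_chain big_ord_recl addrC lerD//.
  by rewrite addn0; apply: cond_meet => //; [exact: finite_part_pull|exact: finite_part_window].
by rewrite (le_trans (IH _))// ler_sum// => k _; rewrite lift0 addnS addSn.
Qed.

Lemma H_meet_le a b : finite_part a -> finite_part b -> H (rmeet a b) <= H a + H b.
Proof.
move=> fa fb; have := H_submod fa fb finite_part_top.
by rewrite !rmeetT H_top addr0 rmeetC.
Qed.

Definition W e n : R := H (window f e 0 n).

Lemma H_window e s n : finite_part e -> H (window f e s n) = W e n.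
Proof.
move=> fe; rewrite /W -(@iter_pull s (window f e 0 n)) ?pull_window ?add0n//.
exact: finite_part_window.
Qed.

Lemma W_add e n k : finite_part e -> W e (n + k) <= W e n + W e k.
Proof.
move=> fe; rewrite {1}/W window_add -(@H_window e (0 + n) k)//.
by apply: H_meet_le; exact: finite_part_window.
Qed.

Lemma W_mul e n k : finite_part e -> W e (k * n) <= k%:R * W e n.
Proof.
move=> fe; elim: k => [|k IH]; first by rewrite mul0n mul0r /W window0 H_top.
rewrite mulSn -natr1 mulrDl mul1r addrC (le_trans (W_add _ _ fe))//; lra.
Qed.

Lemma W_le e n : finite_part e -> W e n <= n%:R * H e.
Proof.
by move=> fe; rewrite -{1}(muln1 n) (le_trans (W_mul _ _ fe))// /W window1.
Qed.

Lemma W_ge0 e n : finite_part e -> 0 <= W e n.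
Proof. by move=> fe; apply/H_ge0/finite_part_window. Qed.

(** Chain rule over [k] blocks of length [m], taken from the last to the first: the block [i] is
    conditioned on the later blocks and on [Z], which by hypothesis determine [Y] shifted by
    [i * m]. *)
Lemma window_step e Y Z m k : finite_part e -> finite_part Y -> finite_part Z ->
  (forall i, (i < k)%N -> subrel (rmeet (window f e (i.+1 * m) ((k - i.+1) * m)) Z)
                                 (pull (iter (i * m) f) Y)) ->
  cond (window f e 0 (k * m)) Z <= k%:R * cond (window f e 0 m) Y.
Proof.
move=> fe fY fZ hY.
have fw s n : finite_part (window f e s n) by exact: finite_part_window.
suff h j : (j <= k)%N -> cond (window f e ((k - j) * m) (j * m)) Z <=
    j%:R * cond (window f e 0 m) Y.
  by have := h _ (leqnn k); rewrite subnn mul0n.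
elim: j => [|j IH] jk.
  by rewrite mul0n window0 mul0r /cond rmeetC rmeetT subrr.
rewrite mulSn window_add cond_chain.
have -> : ((k - j.+1) * m + m = (k - j) * m)%N by rewrite -mulSnr -subSn// subSS.
rewrite -natr1 mulrDl mul1r lerD ?IH ?(ltnW jk)//.
rewrite -(@cond_pull ((k - j.+1) * m) (window f e 0 m) Y)// pull_window add0n.
apply: cond_anti => //; [exact: finite_part_pull|exact: finite_part_meet|].
move=> x y xy; apply: hY; first by lia.
have -> : (k - j.+1).+1 = (k - j)%N by lia.
by have -> : (k - (k - j) = j)%N by lia.
Qed.

(** By subadditivity of [W e] the infimum is the limit of [W e n / n], the entropy rate. *)
Definition ent_rate e : R := inf [set W e n.+1 / n.+1%:R | n in setT].

Let has_inf_rate e : finite_part e -> has_inf [set W e n.+1 / n.+1%:R | n in setT].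
Proof.
move=> fe; split; first by exists (W e 1 / 1%:R), 0%N.
by exists 0 => _ [n _ <-]; rewrite divr_ge0 ?W_ge0.
Qed.

Lemma ent_rate_ge0 e : finite_part e -> 0 <= ent_rate e.
Proof.
move=> fe; apply: lb_le_inf; first by have [] := has_inf_rate fe.
by move=> _ [n _ <-]; rewrite divr_ge0 ?W_ge0.
Qed.

Lemma ent_rate_le e n : finite_part e -> n%:R * ent_rate e <= W e n.
Proof.
move=> fe; case: n => [|n]; first by rewrite mul0r W_ge0.
rewrite mulrC -ler_pdivlMr ?ltr0n//; apply: ge_inf; last by exists n.
by have [] := has_inf_rate fe.
Qed.

(** The bound holds at all multiples of one [n], which leaves room for divisibility and size
    conditions on the block lengths. *)
Lemma ent_rate_approx e theta : finite_part e -> 0 < theta ->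
  exists2 n, (0 < n)%N & forall k, W e (k * n) <= (k * n)%:R * (ent_rate e + theta).
Proof.
move=> fe t0; have [_ [n _ <-]] := inf_adherent t0 (has_inf_rate fe).
rewrite ltr_pdivrMr ?ltr0n// => hn; exists n.+1 => // k.
rewrite (le_trans (W_mul _ _ fe))// natrM -mulrA ler_wpM2l// mulrC ltW//.
Qed.

(** If [m] iterates had less entropy than [m * ent_rate e] given the next [L], then in [k] such
    blocks followed by [L] iterates the deficit would grow linearly in [k], while only [W e L] is
    available to cover it. *)
Lemma ent_rate_cond e m L : finite_part e ->
  m%:R * ent_rate e <= cond (window f e 0 m) (window f e m L).
Proof.
move=> fe; have fw s n : finite_part (window f e s n) by exact: finite_part_window.
have hk k : k%:R * (m%:R * ent_rate e - cond (window f e 0 m) (window f e m L)) <= W e L.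
  have h1 : cond (window f e 0 (k * m)) (window f e (k * m) L) <=
            k%:R * cond (window f e 0 m) (window f e m L).
    apply: window_step => // i ik x y /andP[/windowP h1 /windowP h2].
    rewrite pull_window; apply/windowP => t tL.
    have [tk|kt] := ltnP t (k * m); first by apply: h1; nia.
    by apply: h2; nia.
  have : (k * m + L)%:R * ent_rate e <= W e (k * m + L) by exact: ent_rate_le.
  move: h1; rewrite /cond -{2}(add0n (k * m)%N) -window_add (@H_window _ (k * m) L)// -/(W e _).
  have := ent_rate_ge0 fe; rewrite natrD natrM /cond.
  have L0 : (0 : R) <= L%:R by [].
  by nra.
rewrite -subr_le0 leNgt; apply/negP => d0.
set d := _ - _ in hk d0.
have W0 : 0 <= W e L / d by rewrite divr_ge0 ?W_ge0// ltW.
have := hk (Num.bound (W e L / d)); rewrite leNgt => /negP; apply.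
by rewrite -ltr_pdivrMr// archi_boundP.
Qed.

Section Schedule.
Context (P : rel X) (Q : nat -> rel X) (s m : nat -> nat) (h eta : R).
Hypothesis Pfin : finite_part P.
Hypothesis Qfin : forall j, finite_part (Q j).
Hypothesis QS : forall j, subrel (Q j.+1) (Q j).
Hypothesis QP : forall j, subrel (Q j) P.
Hypothesis m_gt0 : forall j, (0 < m j)%N.
Hypothesis m_dvd : forall j, (m j %| m j.+1)%N.
Hypothesis eta_gt0 : 0 < eta.
Hypothesis W_Q : forall j, W (Q j) (m j) <= (m j)%:R * (ent_rate (Q j) + eta / 2 ^+ j).
Hypothesis W_P : forall n, n%:R * h <= W P n.
Hypothesis sS : forall i, (s i + m i <= s i.+1)%N.
Hypothesis m_large : forall i, (s i)%:R * H (Q i) <= (m i)%:R * eta.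

Lemma subrel_Q i j : (i <= j)%N -> subrel (Q j) (Q i).
Proof.
move=> /subnKC <-; elim: (j - i)%N => [|d IH]; first by rewrite addn0.
by rewrite addnS => x y /QS/IH.
Qed.

Let fw e t n : finite_part e -> finite_part (window f e t n).
Proof. exact: finite_part_window. Qed.

Let subrel_window a b t n : subrel a b -> subrel (window f a t n) (window f b t n).
Proof. by move=> ab x y /windowP xy; apply/windowP => k /xy /ab. Qed.

(** Descending induction on [j], starting at [K] from [ent_rate_cond]. Over a block of length
    [m j.+1], replacing [Q j.+1] by [Q j] loses at most the difference of their block entropies, so
    the rate of [Q j.+1] cancels. The two errors [eta / 2 ^+ j.+1] add up to [eta / 2 ^+ j], and
    [window_step] brings the length down to [m j]. *)
Lemma cond_later_ge j K L : (j <= K)%N ->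
  (m j)%:R * (ent_rate (Q j) - eta / 2 ^+ j) <=
    cond (window f (Q j) 0 (m j)) (later f Q m K j L).
Proof.
move=> jK; rewrite -(subnKC jK); move: (K - j)%N => d {jK}.
elim: d j L => [|d IH] j L.
  rewrite addn0; apply: le_trans (_ : cond (window f (Q j) 0 (m j)) (window f (Q j) (m j) L) <= _).
    apply: le_trans (ent_rate_cond _ _ (Qfin j)).
    by rewrite ler_wpM2l// gerBl divr_ge0 ?exprn_ge0// ltW.
  apply: cond_anti; [exact: fw|exact: finite_part_later|exact: fw|].
  move=> x y /windowP xy; apply/laterP => i t ij tL.
  have ij' : i = j by lia.
  by rewrite ij' in tL *; apply: xy; lia.
rewrite -addSnnS; set K' := (j.+1 + d)%N.
have /dvdnP[k kE] := m_dvd j.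
have k0 : (0 < k)%N by have := m_gt0 j.+1; rewrite kE; case: (k).
set M := m j.+1 in kE.
(* The horizon grows by [M] because [later] is shifted by up to [M]. Its observations of [Q j]
   before time [M] come from the later blocks of the window, and those after [M] from the finer
   [Q j.+1]. *)
have step : cond (window f (Q j) 0 (k * m j)) (later f Q m K' j.+1 (L + M)) <=
    k%:R * cond (window f (Q j) 0 (m j)) (later f Q m K' j L).
  apply: window_step => //; try exact: finite_part_later.
  move=> i ik x y /andP[/windowP xy /laterP xy'].
  have im : (i.+1 * m j <= M)%N by rewrite kE leq_mul2r ik orbT.
  rewrite /pull; apply/laterP => l t lj tL; rewrite -!iterD.
  move: lj; rewrite leq_eqVlt => /andP[/orP[/eqP jl|jl] lK]; last by apply: xy'; lia.
  rewrite -jl in tL *; have [tk|kt] := ltnP (t + i * m j) (k * m j).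
    by apply: xy; nia.
  by apply/QS/xy'; rewrite /K'; lia.
have h1 : cond (window f (Q j.+1) 0 M) (later f Q m K' j.+1 (L + M)) -
          cond (window f (Q j) 0 M) (later f Q m K' j.+1 (L + M)) <=
          W (Q j.+1) M - W (Q j) M.
  apply: cond_diff; [exact: fw|exact: fw|exact: finite_part_later|].
  by move=> x y; apply: subrel_window; exact: QS.
have h2 := IH j.+1 (L + M)%N; rewrite -/K' -/M in h2.
have h3 := W_Q j.+1; rewrite -/M in h3.
have h4 := ent_rate_le M (Qfin j).
have h5 : eta / 2 ^+ j = 2 * (eta / 2 ^+ j.+1).
  by rewrite exprS invfM; field; rewrite expf_neq0.
rewrite -kE in step; have kR : (M%:R : R) = k%:R * (m j)%:R by rewrite kE natrM.
rewrite -(@ler_pM2l _ k%:R) ?ltr0n//; apply: le_trans step.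
rewrite [leLHS]mulrA -kR h5; lra.
Qed.

(** Coarsening [Q j] to [P] costs at most the difference of their block entropies; again the rate of
    [Q j] cancels. *)
Lemma cond_later_P j K L : (j <= K)%N ->
  (m j)%:R * (h - 2 * eta) <= cond (window f P 0 (m j)) (later f Q m K j L).
Proof.
move=> jK; have h1 := cond_later_ge L jK.
have h2 : cond (window f (Q j) 0 (m j)) (later f Q m K j L) -
          cond (window f P 0 (m j)) (later f Q m K j L) <=
          W (Q j) (m j) - W P (m j).
  apply: cond_diff; [exact: fw|exact: fw|exact: finite_part_later|].
  by move=> x y; apply: subrel_window; exact: QP.
have h3 := W_Q j; have h4 := W_P (m j).
have h5 : eta / 2 ^+ j <= eta.
  by rewrite ler_pdivrMr ?exprn_gt0// ler_peMr ?(ltW eta_gt0)// exprn_ege1// ler1n.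
have m0 : (0 : R) <= (m j)%:R by [].
nra.
Qed.

Lemma s_mono i j : (i <= j)%N -> (s i <= s j)%N.
Proof.
move=> /subnKC <-; elim: (j - i)%N => [|d IH]; first by rewrite addn0.
by rewrite addnS (leq_trans IH)// (leq_trans _ (sS _))// leq_addr.
Qed.

(** The observations after time [s i] are implied by [later]. Those before are implied by the
    [Q i]-name of length [s i], whose entropy is at most [m i * eta] because [m i] is large compared
    with [s i]. *)
Lemma cond_agree_ge i K : (i <= K)%N ->
  (m i)%:R * (h - 3 * eta) <= cond (window f P (s i) (m i)) (agree f Q s m K.+1).
Proof.
move=> iK; set a := window f P _ _.
pose z := pull (iter (s i) f) (later f Q m K i (s K.+1)).
pose w := window f (Q i) 0 (s i).
have fz : finite_part z by apply: finite_part_pull; exact: finite_part_later.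
have fa : finite_part a by exact: fw.
have fW : finite_part w by exact: fw.
have faz := finite_part_meet fa fz; have fwz := finite_part_meet fW fz.
have fg := finite_part_agree f s m Qfin K.+1.
have h1 : cond a (rmeet w z) <= cond a (agree f Q s m K.+1).
  apply: cond_anti => // x y /andP[/windowP xy /laterP xy'].
  apply/agreeP => j t jK tj; have [ji|ij] := ltnP j i.
    by apply: (subrel_Q (ltnW ji)); apply: xy; have := s_mono ji; lia.
  have tE : t = ((t - s i) + s i)%N by have := s_mono ij; lia.
  rewrite tE !iterD; apply: xy'; first by lia.
  by have := s_mono ij; have := s_mono jK; lia.
apply: le_trans h1.
have h2 : cond a z <= cond a (rmeet w z) + H w.
  rewrite /cond; have := H_mono (finite_part_meet fa fwz) faz _.
  have : subrel (rmeet a (rmeet w z)) (rmeet a z).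
    by apply: rmeetS => // x y /andP[].
  move=> hs /(_ hs); have := H_meet_le fW fz; lra.
have h3 : cond a z = cond (window f P 0 (m i)) (later f Q m K i (s K.+1)).
  rewrite -[RHS](@cond_pull (s i)); [|exact: fw|exact: finite_part_later].
  by rewrite pull_window add0n.
have h4 := cond_later_P (s K.+1) iK.
have h5 : H w <= (m i)%:R * eta.
  by apply: le_trans (m_large i); exact: W_le.
lra.
Qed.

End Schedule.

(** The recursion for [s] makes the free part and the past together only [1 / (i + 2)] of the time
    up to [s i.+1]; [s i <= m i] makes the free block at least half of the time up to its end. *)
Lemma exists_schedule (P : rel X) (Q : nat -> rel X) (h : R) :
  finite_part P -> (forall j, finite_part (Q j)) ->
  (forall j, subrel (Q j.+1) (Q j)) -> (forall j, subrel (Q j) P) ->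
  0 < h -> (forall n, n%:R * h <= W P n) ->
  exists s m : nat -> nat,
    [/\ forall i, s i.+1 = (i.+2 * (s i + m i))%N,
        forall i, (0 < m i)%N,
        forall i, (s i <= m i)%N &
        forall i K, (i <= K)%N -> (m i)%:R * (h / 2) <=
          cond (window f P (s i) (m i)) (agree f Q s m K.+1)].
Proof.
move=> fP fQ QS QP h0 WP; set eta := h / 6.
have eta0 : 0 < eta by rewrite divr_gt0.
have rate_mult j := ent_rate_approx (fQ j) (divr_gt0 eta0 (exprn_gt0 j (@ltr0Sn R 1))).
pose n1 j := sval (cid2 (rate_mult j)).
have n1_gt0 j : (0 < n1 j)%N by rewrite /n1; case: cid2.
have n1W j k : W (Q j) (k * n1 j) <= (k * n1 j)%:R * (ent_rate (Q j) + eta / 2 ^+ j).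
  by rewrite /n1; case: cid2.
pose c j := (Num.bound (H (Q j) / eta)).+1.
(* The three factors of the new length give divisibility by the previous one, size at least
   [c i * s i], and a multiple of [n1 i], where the block entropy is close to the rate. *)
pose fix sm i := if i is j.+1 then
    let s' := (j.+2 * ((sm j).1 + (sm j).2))%N in
    (s', ((sm j).2 * (c i * s').+1 * n1 i)%N)
  else (0%N, n1 0%N).
pose s i := (sm i).1; pose m i := (sm i).2.
have m0 i : (0 < m i)%N.
  elim: i => [|i IH]; first exact: n1_gt0.
  by rewrite /m /= !muln_gt0 n1_gt0 andbT; exact/andP.
have cm i : (c i * s i <= m i)%N.
  case: i => [|i]; first by rewrite muln0.
  have := m0 i; have := n1_gt0 i.+1; rewrite /s /m /=.
  set u := (c i.+1 * _)%N => n0 mi0.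
  rewrite -mulnA; apply: leq_trans (leq_pmull _ mi0).
  by rewrite (leq_trans (leqnSn u))// leq_pmulr.
exists s, m; split => //.
  by move=> i; apply: leq_trans (cm i); rewrite leq_pmull.
move=> i K iK; have -> : h / 2 = h - 3 * eta by rewrite /eta; field.
apply: cond_agree_ge => //.
- by move=> j; rewrite {2}/m /= -mulnA dvdn_mulr.
- case=> [|j]; last by rewrite /m /=; exact: n1W.
  by have := n1W 0%N 1%N; rewrite mul1n.
- by move=> j; rewrite /s /= leq_pmull.
- move=> j; apply: (@le_trans _ _ ((c j * s j)%:R * eta)); last first.
    by rewrite ler_wpM2r ?(ltW eta0)// ler_nat.
  rewrite mulnC natrM -mulrA ler_wpM2l// -ler_pdivrMr//.
  have b0 : 0 <= H (Q j) / eta by rewrite divr_ge0 ?H_ge0// ltW.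
  by rewrite (le_trans (ltW (archi_boundP b0)))// ler_nat.
Qed.

End EntropyFunctional.

(** * Fano's inequality and separated sets for orbit averages *)

Section OrbitSample.
Context {R : realType} {X : eqType} (f : X -> X).
Context (E : nat -> seq X) (N : nat -> nat).
Hypothesis E_gt0 : forall i, (0 < size (E i))%N.
Hypothesis N_gt : forall i, (i < N i)%N.
Implicit Types (a e : rel X).

Local Notation orbit_ent := (orbit_ent f E N).
Local Notation orbit_avg := (orbit_avg f E N).

Let N_gt0 i : (0 : R) < (N i)%:R.
Proof. by rewrite ltr0n (leq_ltn_trans _ (N_gt i)). Qed.

(** Fano's inequality at each time of the window, with [r] as predictor from the [a]-class, is
    applied to the image of [E i] under each [iter t f] and averaged over [t]. *)
Lemma orbit_fano i (T : finType) (p : X -> T) a (r : X -> X) (u : R) s n :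
  finite_part a -> (forall x y, a x y -> r x = r y) -> 0 < u < 1 ->
  orbit_ent i (rmeet (window f (fun x y => p x == p y) s n) a) - orbit_ent i a <=
    n%:R * - ln (1 - u) + ln (#|T|%:R / u) *
      orbit_avg i (fun x => \sum_(k < n)
        (p (iter (s + k) f x) != p (iter (s + k) f (r x)))%:R).
Proof.
move=> fa ra u01; set e := fun x y => p x == p y.
pose err (k : nat) x : R := (p (iter (s + k) f x) != p (iter (s + k) f (r x)))%:R.
have fe : finite_part e by exact: finite_part_ker.
have key t : ent (E i) (pull (iter t f) (rmeet (window f e s n) a)) -
    ent (E i) (pull (iter t f) a) <=
    n%:R * - ln (1 - u) + ln (#|T|%:R / u) *
      avg (E i) ((fun x => \sum_(k < n) err k x) \o iter t f).
  have em := @ent_map R X (E i) (iter t f).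
  rewrite -(em (rmeet (window f e s n) a)) -(em a) -(@avg_map R X (E i) (iter t f)).
  set S := map _ _.
  have S0 : (0 < size S)%N by rewrite size_map.
  apply: le_trans (@cond_window_le R X f (ent S) (@ent_submod R X S) e a s n fe fa) _.
  rewrite avg_sum mulr_sumr mulr_natl -[X in _ *+ X](card_ord n) -sumr_const -big_split/=.
  apply: ler_sum => k _.
  exact: (@ent_fano R X S a T (p \o iter (s + k) f) r u S0 fa ra u01).
rewrite /orbit_ent /orbit_avg -mulrBr -sumrB.
apply: le_trans; first by apply: time_avg_le => t; exact: key.
by rewrite big_split/= mulrDr (time_avg_cst N_gt) -mulr_sumr mulrCA.
Qed.

(* The sum over [r < n] of the entropies of the windows [0, k + r) grows by at
   most the entropy of [k, k + n) when [k] is incremented. *)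
Lemma sample_window_entropy S e n M : finite_part e ->
  n%:R * ent S (window f e 0 M) <=
    \sum_(r < n) ent S (window f e 0 r) + \sum_(t < M) ent S (window f e t n) :> R.
Proof.
move=> fe; have fw t k : finite_part (window f e t k) by exact: finite_part_window.
pose A k : R := \sum_(r < n) ent S (window f e 0 (k + r)).
have AS k : A k.+1 <= A k + ent S (window f e k n).
  have -> : A k.+1 = A k + (ent S (window f e 0 (k + n)) - ent S (window f e 0 k)).
    rewrite /A; under eq_bigr do rewrite addSnnS.
    pose F r : R := ent S (window f e 0 (k + r)).
    have : F 0%N + \sum_(r < n) F r.+1 = \sum_(r < n) F r + F n.
      rewrite -(big_ord_recr n (fun r : 'I_n.+1 => F r)) big_ord_recl.
      by congr (_ + _); apply: eq_bigr => r _; rewrite lift0.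
    by rewrite /F addn0; lra.
  rewrite lerD2l lerBlDl window_add add0n.
  apply: (H_meet_le (@ent_submod R X S) (@ent_top R X S)) => //.
suff h : A M <= A 0%N + \sum_(t < M) ent S (window f e t n).
  apply: le_trans h; rewrite /A mulr_natl -[X in _ *+ X](card_ord n) -sumr_const.
  apply: ler_sum => r _; apply: ent_mono; first exact: finite_part_refl.
  by move=> x y; rewrite window_add => /andP[].
elim: M => [|k IH]; first by rewrite big_ord0 addr0.
by rewrite big_ord_recr/= (le_trans (AS k))// addrA lerD2r.
Qed.

Context {U : set_system nat} {UU : UltraFilter U}.
Hypothesis ooU : \oo `<=` U.

(** The names of length [N i] separate [E i], so their entropy is the full [ln (size (E i))].
    [sample_window_entropy] distributes it over windows of length [n], up to a boundary term that is
    bounded by [B] and vanishes after division by [N i]. *)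
Lemma separated_mean_ent (P : rel X) (h : R) n : finite_part P ->
  (forall i, uniq (E i)) ->
  (forall i x y, x \in E i -> y \in E i -> window f P 0 (N i) x y -> x = y) ->
  (forall i, (N i)%:R * h <= ln (size (E i))%:R) ->
  n%:R * h <= mean_ent f E N U (window f P 0 n).
Proof.
move=> fP uE sepE hE; have [T [p pE]] := fP.
have fw t k : finite_part (window f P t k) by exact: finite_part_window.
have Emax i : ent (E i) (window f P 0 (N i)) = ln (size (E i))%:R :> R.
  rewrite /ent (@eq_avg _ _ _ _ (fun=> ln (size (E i))%:R)) ?avg_cst// => x xE.
  rewrite /cnt (_ : count _ _ = count_mem x (E i)).
    by rewrite count_uniq_mem// xE divr1.
  apply: eq_in_count => y yE; apply/idP/eqP => [/sepE->//|->].
  exact: finite_part_refl (fw _ _) x.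
pose B : R := \sum_(r < n) (r%:R * ln #|T|%:R).
have WB S r : ent S (window f P 0 r) <= r%:R * ln #|T|%:R :> R.
  rewrite -[leLHS]subr0 -(@ent_top R X S) -{1}(rmeetT (window f P 0 r)).
  apply: le_trans (@cond_window_le R X f (ent S) (@ent_submod R X S) P rtop 0 r fP finite_part_top) _.
  rewrite mulr_natl -[X in _ *+ X](card_ord r) -sumr_const; apply: ler_sum => k _.
  rewrite /cond rmeetC.
  have -> : pull (iter (0 + k) f) P = (fun x y => (p \o iter k f) x == (p \o iter k f) y).
    by apply/funext => x; apply/funext => y; rewrite /pull pE.
  by apply: ent_le_card; exact: finite_part_top.
have bw := @orbit_ent_bounded R X f E N N_gt _ (fw 0%N n).
have key i : n%:R * h - B * harmonic i <= orbit_ent i (window f P 0 n).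
  have h1 := sample_window_entropy (E i) n (N i) fP.
  rewrite Emax in h1.
  have h2 : \sum_(r < n) ent (E i) (window f P 0 r) <= B.
    by apply: ler_sum => r _; exact: WB.
  rewrite /orbit_ent [leRHS]mulrC ler_pdivlMr//.
  under [leRHS]eq_bigr do rewrite pull_window add0n.
  apply: le_trans (_ : n%:R * ln (size (E i))%:R - B <= _); last by lra.
  have B0 : 0 <= B.
    rewrite sumr_ge0// => r _; rewrite mulr_ge0//.
    have := WB (E i) 1%N; rewrite mul1r; apply: le_trans; apply: ent_ge0.
    exact: finite_part_refl.
  have hi : 1 <= harmonic i * (N i)%:R :> R.
    by rewrite mulrC ler_pdivlMr ?ltr0n// mul1r ler_nat.
  have := ler_wpM2l (ler0n R n) (hE i); nra.
have c0 : (fun i => n%:R * h - B * harmonic i) @ U --> (n%:R * h - 0 : R).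
  apply: cvgB; first exact: cvg_cst.
  by move=> A /(@harmonic_scale_cvg0 R B); exact: ooU.
rewrite subr0 in c0.
apply: ler_cvg_to c0 (ulim_cvg bw) _.
by apply: filterS filterT => i _; exact: key.
Qed.

End OrbitSample.

(** * Partitions into balls of a generic radius *)

Section BallPartitions.
Context {R : realType} {X : metricType R}.
Implicit Types (zs : seq X) (r kappa : R).

(** [find] returns [size zs] for a point outside all the balls, hence the extra value. *)
Definition cell zs r (x : X) : 'I_(size zs).+1 :=
  @Ordinal (size zs).+1 (find (fun z => mdist z x < r) zs)
    (find_size (fun z => mdist z x < r) zs).

Definition shell zs r kappa (x : X) : bool :=
  has (fun z => `|mdist z x - r| < kappa) zs.

Lemma finite_net (cX : compact [set: X]) (e : R) : 0 < e ->
  exists zs : seq X, forall x, has (fun z => mdist z x < e) zs.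
Proof.
(* Compactness is used as a near-covering property for the filter of large finite lists. *)
move=> e0; pose F := filter_from setT (fun zs0 : seq X => [set zs : seq X | {subset zs0 <= zs}]).
have FF : Filter F.
  apply: filter_fromT_filter; first by exists [::].
  move=> s1 s2; exists (s1 ++ s2) => zs /= h.
  by split=> z zs1; apply: h; rewrite mem_cat zs1 ?orbT.
have /compact_near_coveringP/(_ _ F (fun zs x => has (fun z => mdist z x < e) zs)) := cX.
case=> // [x _|zs0 _ h]; last by exists zs0 => x; apply: (h zs0).
exists (ball x e, [set zs : seq X | {subset [:: x] <= zs}]) => /=.
  by split; [exact: nbhsx_ballx|exists [:: x]].
move=> [y zs] /= [+ xzs]; rewrite ballEmdist /= => xy.
by apply/hasP; exists x => //; apply: xzs; rewrite mem_head.
Qed.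

Lemma cell_mdist zs r x y : has (fun z => mdist z x < r) zs ->
  cell zs r x = cell zs r y -> mdist x y < 2 * r.
Proof.
move=> hx /(congr1 val)/= xy.
have hy : has (fun z => mdist z y < r) zs by move: hx; rewrite !has_find xy.
have zx := nth_find x hx; have zy := nth_find x hy.
have := metric_triangle x (nth x zs (find (fun z => mdist z x < r) zs)) y.
by rewrite -xy in zy; rewrite metric_sym in zx; lra.
Qed.

(** Away from every shell, a move by less than [kappa] crosses no sphere of radius [r]. *)
Lemma cell_shell zs r kappa x y : cell zs r x != cell zs r y ->
  mdist x y < kappa -> shell zs r kappa x.
Proof.
move=> xy xyk; apply: contraNT xy => /hasPn nsh; apply/eqP/val_inj/eq_in_find => z zzs.
have := nsh _ zzs; rewrite -leNgt => /= h.
have h1 := metric_triangle z y x; have h2 := metric_triangle z x y.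
rewrite (metric_sym y x) in h1.
move: h; rewrite ler_normr => /orP[h|h]; apply/idP/idP; lra.
Qed.

(** The open intervals of radius [kappa] about centres spaced by [2 * kappa] are disjoint. *)
Lemma disjoint_shells n (r0 kappa d : R) : 0 < kappa ->
  \sum_(q < n) (`|d - (r0 + q%:R * (2 * kappa))| < kappa)%R%:R <= 1 :> R.
Proof.
move=> k0; have [[q0 hq0]|no] := pselect (exists q : 'I_n,
    `|d - (r0 + q%:R * (2 * kappa))| < kappa); last first.
  rewrite big1// => q _; apply/eqP; rewrite pnatr_eq0 eqb0.
  by apply/negP => hq; apply: no; exists q.
rewrite (bigD1 q0)//= big1 ?addr0; first by rewrite hq0.
move=> q qq0; apply/eqP; rewrite pnatr_eq0 eqb0; apply/negP => hq.
move/negP: qq0; apply; apply/eqP/val_inj/eqP; rewrite eqn_leq.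
move: hq hq0; rewrite !ltr_norml => /andP[a b] /andP[c e].
have h (u v : nat) : (u%:R - v%:R) * (2 * kappa) < 2 * kappa -> (u <= v)%N.
  case: leqP => // vu; have : v%:R + 1 <= u%:R :> R by rewrite natr1 ler_nat.
  by nra.
by rewrite !h//; lra.
Qed.

Lemma sum_shell_le zs n (r0 kappa : R) x : 0 < kappa ->
  \sum_(q < n) (shell zs (r0 + q%:R * (2 * kappa)) kappa x)%:R <= (size zs)%:R :> R.
Proof.
move=> k0; elim: zs => [|z zs IH]; first by rewrite big1.
have -> : (size (z :: zs))%:R = 1 + (size zs)%:R :> R by rewrite addrC natr1.
apply: le_trans (_ : \sum_(q < n) ((`|mdist z x - (r0 + q%:R * (2 * kappa))| < kappa)%R%:R +
    (shell zs (r0 + q%:R * (2 * kappa)) kappa x)%:R) <= _).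
  by apply: ler_sum => q _; rewrite /shell /= -natrD ler_nat; case: (_ < _)%R; case: (has _ _).
by rewrite big_split/= lerD// disjoint_shells.
Qed.

End BallPartitions.

(** * Laws on pairs that are close on the observed blocks and often far on the free ones *)

Section FarCloseLaw.
Context {R : realType} {X : metricType R} (f : X -> X).
Hypothesis X_compact : compact [set: X].

Definition far_count (kappa : R) s n (x y : X) : R :=
  \sum_(k < n) (kappa <= mdist (iter (s + k) f x) (iter (s + k) f y))%R%:R.

Context (E : nat -> seq X) (N : nat -> nat).
Hypothesis E_gt0 : forall i, (0 < size (E i))%N.
Hypothesis N_gt : forall i, (i < N i)%N.
Context {U : set_system nat} {UU : UltraFilter U}.
Hypothesis ooU : \oo `<=` U.
Context (eps h : R).
Hypothesis eps_gt0 : 0 < eps.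
Hypothesis h_gt0 : 0 < h.
Hypothesis E_uniq : forall i, uniq (E i).
Hypothesis E_sep : forall i x y, x \in E i -> y \in E i -> x <> y ->
  exists2 k, (k < N i)%N & eps < mdist (iter k f x) (iter k f y).
Hypothesis E_size : forall i, (N i)%:R * h <= ln (size (E i))%:R.

Local Notation orbit_avg := (orbit_avg f E N).
Local Notation orbit_ent := (orbit_ent f E N).
Local Notation mean_ent := (mean_ent f E N U).
Local Notation mean_avg := (mean_avg f E N U).

Lemma mean_avg_iter (g : X -> R) B k : (forall x, 0 <= g x <= B) ->
  mean_avg (g \o iter k f) = mean_avg g.
Proof.
elim: k g => [|k IH] g gB; first by congr (_ _ _).
rewrite -[RHS](mean_avg_pull f E_gt0 N_gt ooU gB) -(IH (g \o f))//.
by move=> x; exact: gB.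
Qed.

(** Pigeonhole: the shells of [n] spaced radii cover each point at most [size zs] times, so one of
    them has mean at most [size zs / n]. *)
Lemma exists_small_shell zs (gamma e : R) : 0 < gamma -> 0 < e ->
  exists r kappa : R, [/\ e / 4 <= r < e / 2, 0 < kappa &
    mean_avg (fun x => (shell zs r kappa x)%:R) <= gamma].
Proof.
move=> g0 e0; set n := (Num.bound ((size zs)%:R / gamma : R)).+1.
have n0 : (0 : R) < n%:R by rewrite ltr0n.
have ln : (size zs)%:R < gamma * n%:R.
  rewrite mulrC -ltr_pdivrMr//; apply: lt_le_trans (archi_boundP _) _.
    by rewrite divr_ge0// ltW.
  by rewrite ler_nat.
(* With spacing [2 * kappa = e / (4 * n)] the [n] radii stay in [[e / 4, e / 2)]. *)
set kappa := e / (8 * n%:R); have k0 : 0 < kappa by rewrite divr_gt0// mulr_gt0.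
pose r q : R := e / 4 + q%:R * (2 * kappa).
pose g q (x : X) : R := (shell zs (r q) kappa x)%:R.
have bg q : bounded_seq (orbit_avg^~ (g q)).
  by apply: (orbit_avg_bounded _ E_gt0 N_gt); exists 1 => x; rewrite /g ler0n lern1 leq_b1.
have [q qn gq] : exists2 q, (q < n)%N & mean_avg (g q) <= gamma.
  apply/not_exists2P => no.
  have : \sum_(q < n) gamma <= \sum_(q < n) mean_avg (g q).
    apply: ler_sum => q _; rewrite leNgt; apply/negP => lt.
    by have [] := no q; [move=> /(_ (ltn_ord q))|rewrite (ltW lt)].
  rewrite sumr_const card_ord -[leLHS]mulr_natr leNgt => /negP; apply.
  apply: le_lt_trans ln; rewrite -(@ulim_sum _ _ _ (fun q i => orbit_avg i (g q)))//.
  rewrite -(@ulim_cst R U UU (size zs)%:R); apply: ulim_le.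
  - exact: (@bounded_seq_sum R (fun q i => orbit_avg i (g q))).
  - exact: bounded_seq_cst.
  apply: filterS filterT => i _ /=.
  rewrite -(orbit_avg_sum f E N i n g) -[leRHS](orbit_avg_cst f E_gt0 N_gt i).
  by apply: orbit_avg_le => // x; exact: sum_shell_le.
exists (r q), kappa; split => //; rewrite /r lerDl.
apply/andP; split; first by rewrite mulr_ge0// mulr_ge0// ltW.
have -> : kappa = e / 8 / n%:R by rewrite /kappa invfM mulrA.
have : q%:R / n%:R < 1 :> R by rewrite ltr_pdivrMr// mul1r ltr_nat.
set w := q%:R / n%:R => w1; have -> : q%:R * (2 * (e / 8 / n%:R)) = e / 4 * w.
  by rewrite /w; field; rewrite gt_eqF.
nra.
Qed.

Lemma exists_far_close_law : exists (gamma kappa : R) (s m : nat -> nat),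
  [/\ 0 < gamma, 0 < kappa,
      forall i, s i.+1 = (i.+2 * (s i + m i))%N /\ (0 < m i)%N /\ (s i <= m i)%N &
      forall K, exists i (r : X -> X),
        (forall z j t, (j <= K)%N -> (s j + m j <= t < s j.+1)%N ->
           mdist (iter t f z) (iter t f (r z)) < j.+1%:R^-1) /\
        (forall j, (j <= K)%N -> gamma <= orbit_avg i (fun z =>
           (gamma * (m j)%:R <= far_count kappa (s j) (m j) z (r z))%R%:R))].
Proof.
(* A net at scale [eps / 4] covers for each [r >= eps / 4], and [r < eps / 2] keeps two points of a
   cell closer than [eps]. *)
have [zs zsP] := @finite_net R X X_compact _ (divr_gt0 eps_gt0 (@ltr0Sn R 3)).
(* Of the rate [h / 4] kept on a free block, the constant term of Fano's inequality takes [h / 8].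
   The other [h / 8 = c * (4 * gamma)] forces an error rate above [4 * gamma]. *)
set u := 1 - expR (- (h / 8)); set T := 'I_(size zs).+1.
have u01 : 0 < u < 1.
  rewrite /u subr_gt0 -[ltRHS]expR0 ltr_expR oppr_lt0 divr_gt0//=.
  by rewrite gtrBl expR_gt0.
have lnu : - ln (1 - u) = h / 8.
  by rewrite /u opprB addrCA subrr addr0 expRK opprK.
have c0 : 0 < ln (#|T|%:R / u).
  rewrite ln_gt0// ltr_pdivlMr ?mul1r; last by case/andP: u01.
  case/andP: u01 => _ u1; apply: lt_le_trans u1 _.
  by rewrite card_ord ler1n.
set c := ln _ in c0; set gamma := h / (32 * c).
have g0 : 0 < gamma by rewrite divr_gt0// mulr_gt0.
have [r [kappa [/andP[r1 r2] k0 rsh]]] := exists_small_shell zs g0 eps_gt0.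
pose p := cell zs r.
pose P : rel X := fun x y => p x == p y.
have fP : finite_part P by exact: finite_part_ker.
have netr x : has (fun z => mdist z x < r) zs.
  by apply: sub_has (zsP x) => z zx; exact: lt_le_trans r1.
have nets j : exists zs : seq X, forall x, has (fun z => mdist z x < (2 * j.+1%:R)^-1) zs.
  by apply: finite_net => //; rewrite invr_gt0.
pose ns j := sval (cid (nets j)).
have nsP j x : has (fun z => mdist z x < (2 * j.+1%:R)^-1) (ns j).
  by rewrite /ns; case: cid.
pose B j : rel X := fun x y => cell (ns j) (2 * j.+1%:R)^-1 x == cell (ns j) (2 * j.+1%:R)^-1 y.
(* All earlier ball partitions are included so that each [Q j] refines its predecessors. *)
pose Q j : rel X := rmeet P (fun x y => all (fun i => B i x y) (iota 0 j.+1)).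
have fQ j : finite_part (Q j).
  by apply: finite_part_meet => //; apply: finite_part_all => i; exact: finite_part_ker.
have QS j : subrel (Q j.+1) (Q j).
  by move=> x y; rewrite /Q /rmeet -[in iota 0 j.+2]addn1 iotaD all_cat => /and3P[-> ->].
have QP j : subrel (Q j) P by move=> x y /andP[].
have Qd j x y : Q j x y -> mdist x y < j.+1%:R^-1.
  move=> /andP[_ /allP/(_ j)]; rewrite mem_iota /= add0n ltnSn => /(_ isT)/eqP xy.
  have := cell_mdist (nsP j x) xy.
  by rewrite invfM mulrA divff// mul1r.
have WP n : n%:R * h <= W f mean_ent P n.
  apply: (separated_mean_ent E_gt0 N_gt ooU) => // i x y xE yE /windowP xy.
  apply/eqP/negP => /negP/eqP xny; have [k kN] := E_sep xE yE xny.
  apply/negP; rewrite -leNgt.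
  have /eqP/(cell_mdist (netr _)) := xy k kN; lra.
have [s [m [sS m0 sm hc]]] := exists_schedule (mean_ent_mono f E N_gt)
  (mean_ent_submod f E N_gt) (mean_ent_top f E N)
  (mean_ent_pull f E N_gt ooU) fP fQ QS QP h_gt0 WP.
exists gamma, kappa, s, m; split => // K.
pose a := agree f Q s m K.+1.
have fa : finite_part a by exact: finite_part_agree.
have [x0 _] : exists x, x \in E 0%N.
  by move: (E_gt0 0%N); case: (E 0%N) => // x l _; exists x; exact: mem_head.
(* The chosen point depends on the [a]-class alone, so it is an admissible predictor for Fano's
   inequality, and it shares all observations with [z]. *)
pose rep (z : X) := xget x0 [set y | a z y].
have arep z : a z (rep z).
  by apply: (@xgetPex _ x0 [set y | a z y]); exists z; exact: finite_part_refl fa z.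
have rep_eq x y : a x y -> rep x = rep y by move=> /(finite_part_eql fa) xy; rewrite /rep xy.
pose shsum j x : R := \sum_(k < m j) (shell zs r kappa (iter (s j + k) f x))%:R.
have fw j : finite_part (rmeet (window f P (s j) (m j)) a).
  by apply: finite_part_meet => //; exact: finite_part_window.
have bent b : finite_part b -> bounded_seq (orbit_ent^~ b) by exact: orbit_ent_bounded.
have good_ent j : (j <= K)%N -> U [set i | (m j)%:R * (h / 4) <
    orbit_ent i (rmeet (window f P (s j) (m j)) a) - orbit_ent i a].
  move=> jK; apply: ulim_gt.
    by apply: bounded_seqD; [exact: bent|apply: bounded_seqN; exact: bent].
  rewrite ulimB; [|exact: bent|exact: bent].
  apply: lt_le_trans (hc _ _ jK).
  by rewrite ltr_pM2l ?ltr0n//; move: h_gt0; lra.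
have good_sh j : U [set i | orbit_avg i (shsum j) < (m j)%:R * (2 * gamma)].
  apply: ulim_lt.
    apply: orbit_avg_bounded => //; exists (m j)%:R => x; rewrite sumr_ge0//=.
    rewrite -[X in _ <= X%:R](card_ord (m j)) -sum1_card natr_sum ler_sum// => k _.
    by rewrite ler_nat leq_b1.
  have -> : ulim U (orbit_avg^~ (shsum j)) = (m j)%:R * mean_avg (fun x => (shell zs r kappa x)%:R).
    rewrite (_ : orbit_avg^~ (shsum j) = fun i => \sum_(k < m j)
        orbit_avg i (fun x => (shell zs r kappa (iter (s j + k) f x))%:R)); last first.
      apply/funext => i.
      exact: (@orbit_avg_sum R X f E N i (m j) (fun k x => (shell zs r kappa (iter (s j + k) f x))%:R)).
    rewrite (@ulim_sum _ _ _ (fun k i => orbit_avg i (fun x => (shell zs r kappa (iter (s j + k) f x))%:R))); last first.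
      by move=> k; apply: orbit_avg_bounded => //; exists 1 => x; rewrite ler0n lern1 leq_b1.
    rewrite mulr_natl -[X in _ *+ X](card_ord (m j)) -sumr_const; apply: eq_bigr => k _.
    apply: (@mean_avg_iter (fun x => (shell zs r kappa x)%:R) 1 (s j + k)) => x.
    by rewrite ler0n lern1 leq_b1.
  by rewrite ltr_pM2l ?ltr0n//; move: rsh g0; lra.
(* Finitely many conditions, each on a set of the ultrafilter, hold at a common index. *)
have [i hi] : exists i, forall j : 'I_K.+1,
    (m j)%:R * (h / 4) < orbit_ent i (rmeet (window f P (s j) (m j)) a) - orbit_ent i a /\
    orbit_avg i (shsum j) < (m j)%:R * (2 * gamma).
  apply: (@filter_ex _ U); apply: filter_forall => j; apply: filterI.
    by apply: good_ent; rewrite -ltnS.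
  exact: good_sh.
exists i, rep; split.
  move=> z j t jK tj; apply: Qd; have /agreeP := arep z.
  by apply.
move=> j jK; have := hi (Ordinal (jK : (j < K.+1)%N)) => /= -[h1 h2].
have h3 := orbit_fano f E_gt0 N_gt i p (s j) (m j) fa rep_eq u01.
(* Points in different cells are at distance at least [kappa] unless the first lies in the shell,
   which takes less than [2 * gamma] of the error rate. *)
have h4 : orbit_avg i (fun x => \sum_(k < m j)
        (p (iter (s j + k) f x) != p (iter (s j + k) f (rep x)))%:R) <=
    orbit_avg i (fun x => far_count kappa (s j) (m j) x (rep x) + shsum j x).
  apply: orbit_avg_le => // x; rewrite /far_count /shsum -big_split/=.
  apply: ler_sum => k _; rewrite -natrD ler_nat.
  case: (boolP (p _ != _)) => // pk; case: leP => // dk.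
  by rewrite (cell_shell pk dk).
rewrite orbit_avgD in h4.
(* Markov's inequality: a far rate above [2 * gamma] on average exceeds the threshold [gamma] with
   probability at least [gamma]. *)
set G := fun z : X => _; have h5 : orbit_avg i (fun x => far_count kappa (s j) (m j) x (rep x)) <=
    (m j)%:R * orbit_avg i G + gamma * (m j)%:R.
  rewrite -orbit_avgZ -[X in _ + X](orbit_avg_cst f E_gt0 N_gt i) -orbit_avgD.
  apply: orbit_avg_le => // x; rewrite /G; case: (leP (gamma * _)) => fx /=.
    rewrite mulr1 (le_trans (_ : _ <= (m j)%:R))//; last by rewrite lerDl mulr_ge0// ltW.
    rewrite /far_count -[X in _ <= X%:R](card_ord (m j)) -sum1_card natr_sum ler_sum// => k _.
    by rewrite ler_nat leq_b1.
  by rewrite mulr0 add0r ltW.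
have m0' : (0 : R) < (m j)%:R by rewrite ltr0n.
rewrite -(ler_pM2l m0').
have ch : c * gamma = h / 32 by rewrite /gamma; field; rewrite gt_eqF.
rewrite lnu -/c in h3; set A := orbit_avg i _ in h3 h4; set F := orbit_avg i _ in h4 h5.
have h6 : (m j)%:R * (4 * gamma) < A.
  rewrite -(ltr_pM2l c0) mulrCA mulrCA.
  have -> : c * ((m j)%:R * (4 * gamma)) = (m j)%:R * (4 * (c * gamma)) by ring.
  by rewrite ch; move: h1 h3; lra.
by move: h4 h2 h5 h6; lra.
Qed.

End FarCloseLaw.

(** * A reverse Fatou lemma for finitely additive laws *)

Section ReverseFatou.
Context {R : realType} {T : Type} (nu : (T -> bool) -> R) (G : nat -> T -> bool).
Hypothesis nu_le1 : forall A, nu A <= 1.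
Hypothesis nu_mono : forall A B : T -> bool, (forall x, A x -> B x) -> nu A <= nu B.
Hypothesis nu_split : forall A B : T -> bool,
  nu A = nu (fun x => A x && B x) + nu (fun x => A x && ~~ B x).

Definition hits m n x := has (fun i => G i x) (iota m (n - m)).

Let hitsW m m' n n' x : (m' <= m)%N -> (n <= n')%N -> hits m n x -> hits m' n' x.
Proof.
move=> mm nn /hasP[i]; rewrite mem_iota => im Gi.
by apply/hasP; exists i => //; rewrite mem_iota; lia.
Qed.

(* The measure is only finitely additive, whence the truncation of the
   union over [i >= m] at a rank [M m]. *)
Lemma reverse_fatou gamma : 0 < gamma -> (forall i, gamma <= nu (G i)) ->
  exists M : nat -> nat, forall k,
    0 < nu (fun x => all (fun m => hits m (M m) x) (iota 0 k.+1)).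
Proof.
move=> g0 hG; pose S m := [set nu (hits m n) | n in setT].
have hS m : has_sup (S m).
  split; first by exists (nu (hits m 0)), 0%N.
  by exists 1 => _ [n _ <-].
(* The truncation errors sum to less than [gamma / 2], so mass above [gamma / 2] survives. *)
have ex m : exists n, sup (S m) - gamma / 2 ^+ m.+2 < nu (hits m n).
  have e0 : 0 < gamma / 2 ^+ m.+2 by rewrite divr_gt0// exprn_gt0.
  by have [_ [n _ <-]] := sup_adherent e0 (hS m); exists n.
pose M m := sval (cid (ex m)).
have MP m n : (M m <= n)%N ->
    nu (fun x => hits m n x && ~~ hits m (M m) x) <= gamma / 2 ^+ m.+2.
  move=> Mn; have := svalP (cid (ex m)); rewrite -/(M m).
  have h1 : nu (hits m n) <= sup (S m).
    by apply: ub_le_sup; [have [] := hS m|exists n].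
  have := nu_split (hits m n) (hits m (M m)).
  have : nu (hits m (M m)) <= nu (fun x => hits m n x && hits m (M m) x).
    by apply: nu_mono => x hx; rewrite hx (hitsW _ Mn hx).
  lra.
(* This [n] exceeds [k] and every [M j] with [j <= k], so [hits k n] contains [G k] and implies
   [hits j n]. *)
exists M => k; pose n := (\sum_(j < k.+1) M j + k.+1)%N.
have Mn j : (j <= k)%N -> (M j <= n)%N.
  move=> jk; rewrite /n (bigD1 (Ordinal (jk : (j < k.+1)%N)))//= -addnA leq_addr//.
suff h l : (l <= k.+1)%N -> nu (hits k n) - gamma / 2 * (1 - (2 ^+ l)^-1) <=
    nu (fun x => hits k n x && all (fun m => hits m (M m) x) (iota 0 l)).
  have := h _ (leqnn k.+1).
  have : gamma <= nu (hits k n).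
    apply: le_trans (hG k) _; apply: nu_mono => x Gx.
    by apply/hasP; exists k => //; rewrite mem_iota /n; lia.
  have : (0 : R) < (2 ^+ k.+1)^-1 by rewrite invr_gt0 exprn_gt0.
  move=> p0 hk hk'; apply: (@lt_le_trans _ _ (nu (fun x => hits k n x && all (fun m => hits m (M m) x) (iota 0 k.+1)))).
    by apply: lt_le_trans hk'; nra.
  by apply: nu_mono => x /andP[].
elim: l => [|l IH] lk.
  rewrite expr0 invr1 subrr mulr0 subr0; apply: nu_mono => x /= ->//.
apply: le_trans (_ : _ <= nu (fun x => (hits k n x && all (fun m => hits m (M m) x) (iota 0 l)) && hits l (M l) x)) _; last first.
  by apply: nu_mono => x; rewrite -[in iota 0 l.+1]addn1 iotaD all_cat /= andbT andbA.
have h1 := nu_split (fun x => hits k n x && all (fun m => hits m (M m) x) (iota 0 l)) (hits l (M l)).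
have h2 : nu (fun x => (hits k n x && all (fun m => hits m (M m) x) (iota 0 l)) && ~~ hits l (M l) x) <= gamma / 2 ^+ l.+2.
  apply: le_trans (MP l n (Mn _ lk)); apply: nu_mono => x /andP[/andP[hk _] ->].
  by rewrite andbT; apply: hitsW hk.
have h3 := IH (ltnW lk).
have h4 : gamma / 2 ^+ l.+2 = gamma / 4 * (2 ^+ l)^-1.
  by rewrite 2!exprS; field; rewrite expf_neq0.
have h5 : (2 ^+ l.+1)^-1 = (2 ^+ l)^-1 / 2 :> R.
  by rewrite exprS; field; rewrite expf_neq0.
rewrite h5; rewrite h4 in h2; lra.
Qed.

End ReverseFatou.

(** * From laws on pairs to a single limit pair *)

Section LimitPair.
Context {R : realType} {X : metricType R}.

Lemma near_mdist_lt (U : set_system nat) (FU : Filter U) (u v : nat -> X) x y (c : R) :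
  u @ U --> x -> v @ U --> y -> mdist x y < c -> \forall n \near U, mdist (u n) (v n) < c.
Proof.
move=> ux vy xyc; have e0 : 0 < (c - mdist x y) / 2 by rewrite divr_gt0// subr_gt0.
near=> n; have h1 : mdist x (u n) < (c - mdist x y) / 2 by near: n; exact: (metricType_numDomainType.cvgr_dist_lt _ e0).
have h2 : mdist y (v n) < (c - mdist x y) / 2 by near: n; exact: (metricType_numDomainType.cvgr_dist_lt _ e0).
have := metric_triangle (u n) x (v n); have := metric_triangle x y (v n).
by rewrite (metric_sym (u n) x); lra.
Unshelve. all: by end_near. Qed.

Lemma near_mdist_gt (U : set_system nat) (FU : Filter U) (u v : nat -> X) x y (c : R) :
  u @ U --> x -> v @ U --> y -> c < mdist x y -> \forall n \near U, c < mdist (u n) (v n).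
Proof.
move=> ux vy xyc; have e0 : 0 < (mdist x y - c) / 2 by rewrite divr_gt0// subr_gt0.
near=> n; have h1 : mdist x (u n) < (mdist x y - c) / 2 by near: n; exact: (metricType_numDomainType.cvgr_dist_lt _ e0).
have h2 : mdist y (v n) < (mdist x y - c) / 2 by near: n; exact: (metricType_numDomainType.cvgr_dist_lt _ e0).
have := metric_triangle x (u n) y; have := metric_triangle (u n) (v n) y.
by rewrite (metric_sym (v n) y); lra.
Unshelve. all: by end_near. Qed.

Context (f : X -> X).
Hypothesis f_cont : continuous f.
Hypothesis X_compact : compact [set: X].

Lemma continuous_iter t : continuous (iter t f).
Proof.
elim: t => [|t IH] x; first exact: cvg_id.
by apply: (@continuous_comp _ _ _ (iter t f) f); [exact: IH|exact: f_cont].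
Qed.

Context (U : set_system nat) {UU : UltraFilter U}.
Hypothesis ooU : \oo `<=` U.

Let U_ge k : U [set n | (k <= n)%N].
Proof. by apply: ooU; exists k. Qed.

(** The [K]-th law controls only the blocks up to [K]; its limit along [U] is a finitely additive
    law for which every free block is good with mass at least [gamma]. Reverse Fatou yields pairs
    with a good block in [[l, M l)] for each [l <= k]. As [M l] is independent of [k], these
    conditions survive the limit of the pairs. *)
Lemma exists_far_close_pair (E : nat -> seq X) (N : nat -> nat) (eps h : R) :
  (forall i, (0 < size (E i))%N) -> (forall i, (i < N i)%N) ->
  0 < eps -> 0 < h -> (forall i, uniq (E i)) ->
  (forall i x y, x \in E i -> y \in E i -> x <> y ->
     exists2 k, (k < N i)%N & eps < mdist (iter k f x) (iter k f y)) ->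
  (forall i, (N i)%:R * h <= ln (size (E i))%:R) ->
  exists (x y : X) (gamma kappa : R) (s m : nat -> nat),
  [/\ 0 < gamma, 0 < kappa,
      forall i, s i.+1 = (i.+2 * (s i + m i))%N /\ (0 < m i)%N /\ (s i <= m i)%N,
      forall j t, (s j + m j <= t < s j.+1)%N ->
        mdist (iter t f x) (iter t f y) <= j.+1%:R^-1 &
      forall k, exists2 i, (k <= i)%N &
        gamma * (m i)%:R <= far_count f kappa (s i) (m i) x y].
Proof.
move=> E0 Nn eps0 h0 uE sE hE.
have [gamma [kappa [s [m [g0 k0 sm law]]]]] :=
  exists_far_close_law X_compact E0 Nn ooU eps0 h0 uE sE hE.
have [iK hiK] := choice law; have [rK hK] := choice hiK.
pose G i (p : X * X) := gamma * (m i)%:R <= far_count f kappa (s i) (m i) p.1 p.2.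
pose nuK (A : X * X -> bool) K : R :=
  orbit_avg f E N (iK K) (fun z => (A (z, rK K z))%:R).
have bnu A : bounded_seq (nuK A).
  exists 1 => K; rewrite ger0_norm; last by apply: orbit_avg_ge0.
  rewrite -[leRHS](orbit_avg_cst f E0 Nn (iK K)); apply: orbit_avg_le => // z.
  by rewrite lern1 leq_b1.
pose nu A := ulim U (nuK A).
have nu1 A : nu A <= 1.
  rewrite /nu -(@ulim_cst R U UU 1); apply: ulim_le => //; first exact: bounded_seq_cst.
  apply: filterS filterT => K _ /=.
  rewrite -[leRHS](orbit_avg_cst f E0 Nn (iK K)); apply: orbit_avg_le => // z.
  by rewrite lern1 leq_b1.
have numono (A B : X * X -> bool) : (forall p, A p -> B p) -> nu A <= nu B.
  move=> AB; apply: ulim_le => //; apply: filterS filterT => K _ /=.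
  apply: orbit_avg_le => // z; rewrite ler_nat.
  by case: (boolP (A _)) => // /AB ->.
have nusplit (A B : X * X -> bool) : nu A = nu (fun x => A x && B x) + nu (fun x => A x && ~~ B x).
  rewrite /nu -ulimD//; congr (ulim U _); apply/funext => K; rewrite /nuK -orbit_avgD.
  congr (orbit_avg _ _ _ _ _); apply/funext => z; rewrite -natrD; congr (_%:R).
  by case: (A _); case: (B _).
have nuG i : gamma <= nu (G i).
  rewrite -(@ulim_cst R U UU gamma); apply: ulim_le => //; first exact: bounded_seq_cst.
  apply: filterS (U_ge i) => K /= iK'; have [_] := hK K.
  by move=> /(_ i iK').
have [M hM] := reverse_fatou nu1 numono nusplit g0 nuG.
have pairs k : exists p : X * X,
    (forall j t, (j <= k)%N -> (s j + m j <= t < s j.+1)%N ->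
      mdist (iter t f p.1) (iter t f p.2) < j.+1%:R^-1) /\
    forall l, (l <= k)%N -> exists2 i, (l <= i < M l)%N & G i p.
  have [K [/= kK nuK0]] := filter_ex (filterI (U_ge k) (ulim_gt (bnu _) (hM k))).
  have [z] := orbit_avg_exists E0 Nn nuK0.
  rewrite ltr0n lt0b => hz0.
  have /allP hz : all (fun l => hits G l (M l) (z, rK K z)) (iota 0 k.+1) by exact: hz0.
  exists (z, rK K z); split.
    by move=> j t jk tj; have [+ _] := hK K; apply => //; exact: leq_trans kK.
  move=> l lk; have /hz/hasP[i] : l \in iota 0 k.+1 by rewrite mem_iota; lia.
  by rewrite mem_iota => li Gi; exists i => //; lia.
have [pk hpk] := choice pairs.
have [x _ cx] := @ultra_cvg_compact U UU X (fst \o pk) setT X_compact (fun=> I).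
have [y _ cy] := @ultra_cvg_compact U UU X (snd \o pk) setT X_compact (fun=> I).
have cxt t : (fun k => iter t f (pk k).1) @ U --> iter t f x.
  exact: (cvg_comp _ _ cx (@continuous_iter t x)).
have cyt t : (fun k => iter t f (pk k).2) @ U --> iter t f y.
  exact: (cvg_comp _ _ cy (@continuous_iter t y)).
exists x, y, gamma, kappa, s, m; split => //.
  move=> j t tj; rewrite leNgt; apply/negP => far.
  have [k [/= jk]] := filter_ex (filterI (U_ge j) (near_mdist_gt _ (cxt t) (cyt t) far)).
  move=> gt; have [lt _] := hpk k.
  by have := lt_trans gt (lt _ _ jk tj); rewrite ltxx.
(* [B] bounds all times in the free blocks below [M l]. On these finitely many times a distance
   below [kappa] in the limit is already below [kappa] for some [pk k], so the far count does not
   drop. *)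
move=> l; pose B := (\sum_(i < M l) (s i + m i))%N.
have near_kappa : U [set k | forall t : 'I_B,
    mdist (iter t f x) (iter t f y) < kappa ->
    mdist (iter t f (pk k).1) (iter t f (pk k).2) < kappa].
  apply: filter_forall => t; have [lt|ge] := ltP (mdist (iter t f x) (iter t f y)) kappa.
    by apply: filterS (near_mdist_lt _ (cxt t) (cyt t) lt).
  by apply: filterS filterT.
have [k [/= lk nk]] := filter_ex (filterI (U_ge l) near_kappa).
have [_ /(_ _ lk)[i /andP[li iM] Gi]] := hpk k.
exists i => //; apply: le_trans Gi _; apply: ler_sum => t _; rewrite ler_nat.
have tB : (s i + t < B)%N.
  by rewrite /B (bigD1 (Ordinal iM))//= ltn_addr// ltn_add2l.
have [_|lt] := leP kappa (mdist (iter (s i + t) f x) (iter (s i + t) f y)).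
  exact: leq_b1.
by have := nk (Ordinal tB) lt; rewrite ltNge => /negbTE /= ->.
Qed.

End LimitPair.

(** * Limits of frequencies and the DC2 pair *)

Section LimSup.
Context {R : realType}.
Implicit Types (u : nat -> \bar R) (c : \bar R).

Lemma limn_esup_ge u c :
  (forall n0, exists2 n, (n0 <= n)%N & (c <= u n)%E) -> (c <= limn_esup u)%E.
Proof.
move=> h; apply: le_ereal_inf_tmp => _ [V [n0 _ hV] <-].
have [n nn cn] := h n0; apply: le_trans cn _; apply: ereal_sup_ubound.
by exists n => //; exact: hV.
Qed.

Lemma limn_esup_le u c :
  (exists n0, forall n, (n0 <= n)%N -> (u n <= c)%E) -> (limn_esup u <= c)%E.
Proof.
move=> [n0 h]; apply: (@le_trans _ _ (ereal_sup (u @` [set n | (n0 <= n)%N]))).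
  by apply: ereal_inf_lbound; exists [set n | (n0 <= n)%N] => //; exists n0.
by apply: ge_ereal_sup => _ [n /= nn <-]; exact: h.
Qed.

Lemma limn_einf_le u c :
  (forall n0, exists2 n, (n0 <= n)%N & (u n <= c)%E) -> (limn_einf u <= c)%E.
Proof.
move=> h; rewrite /limn_einf leeNl; apply: limn_esup_ge => n0.
by have [n nn un] := h n0; exists n => //; rewrite leeN2.
Qed.

End LimSup.

Section FarClosePair.
Context {R : realType} {X : metricType R} (f : X -> X) (x y : X).

Definition close_count (delta : R) n : nat :=
  \sum_(k < n) (mdist (iter k f x) (iter k f y) < delta)%R.

Lemma close_freqE delta m :
  close_freq f x y delta m = m%:R^-1 * (close_count delta m.+1)%:R.
Proof.
by rewrite /close_freq /close_count -sum1_card big_mkcond/=; congr (_ * _%:R).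
Qed.

Lemma close_count_le delta n : (close_count delta n <= n)%N.
Proof.
by rewrite -[leqRHS]card_ord -sum1_card; apply: leq_sum => k _; exact: leq_b1.
Qed.

Lemma close_count_block delta b n :
  (forall t, (b <= t < n)%N -> mdist (iter t f x) (iter t f y) < delta) ->
  (n - b <= close_count delta n)%N.
Proof.
elim: n => [|n IH] hn; first by rewrite sub0n.
rewrite /close_count big_ord_recr/= -/(close_count delta n).
have := IH (fun t bt => hn t ltac:(lia)); have [bn|nb] := leqP b n; last by lia.
by rewrite hn ?bn ?ltnSn//; lia.
Qed.

Lemma close_count_far kappa s m :
  (close_count kappa (s + m))%:R + far_count f kappa s m x y <= (s + m)%:R :> R.
Proof.
rewrite /close_count big_split_ord/= natrD -/(close_count kappa s).
rewrite -addrA [leRHS]natrD lerD ?ler_nat ?close_count_le//.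
rewrite natr_sum -big_split/= -[X in _ <= X%:R](card_ord m) -sum1_card natr_sum.
by apply: ler_sum => k _; rewrite -natrD ler_nat; case: leP.
Qed.

(** [sup] is an upper bound only for a bounded set; a finite net of radius 1 bounds all
    distances. *)
Lemma mdist_le_diam (cX : compact [set: X]) (a b : X) : mdist a b <= @diam R X.
Proof.
have [zs zsP] := finite_net cX (@ltr01 R).
pose B : R := \sum_(z <- zs) \sum_(w <- zs) mdist z w.
apply: ub_le_sup; last by exists (a, b).
exists (2 + B) => _ [[p q] _ <-] /=.
have /hasP[z zzs zp] := zsP p; have /hasP[w wzs wq] := zsP q.
have zw : mdist z w <= B.
  rewrite /B (big_rem z)//= (big_rem w)//= -addrA lerDl addr_ge0//.
    by apply: sumr_ge0 => v _; exact: mdist_ge0.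
  by apply: sumr_ge0 => v _; apply: sumr_ge0 => v' _; exact: mdist_ge0.
have := metric_triangle p z q; have := metric_triangle z w q.
by rewrite (metric_sym p z); lra.
Qed.

(** The upper frequency is read at the ends of observed blocks, which fill almost all the past. The
    lower one is read at the ends of good free blocks, which fill at least half of it. *)
Lemma far_close_pair_DC2 (gamma kappa : R) (s m : nat -> nat) :
  compact [set: X] -> 0 < gamma -> 0 < kappa ->
  (forall i, s i.+1 = (i.+2 * (s i + m i))%N /\ (0 < m i)%N /\ (s i <= m i)%N) ->
  (forall j t, (s j + m j <= t < s j.+1)%N ->
     mdist (iter t f x) (iter t f y) <= j.+1%:R^-1) ->
  (forall k, exists2 i, (k <= i)%N &
     gamma * (m i)%:R <= far_count f kappa (s i) (m i) x y) ->
  DC2_pair f x y.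
Proof.
move=> cX g0 k0 sm close far; have s_ge i : (i <= s i)%N.
  elim: i => // i IH; have [-> [m0 _]] := sm i; nia.
split=> [delta /andP[d0 _]|].
  apply/eqP; rewrite eq_le; apply/andP; split.
    (* Since [m + 1] times are counted and divided by [m], the frequency may exceed 1 by [1 / m]. *)
    apply/lee_addgt0Pr => e e0; apply: limn_esup_le.
    exists (Num.bound (e^-1)).+1 => n bn.
    have n0 : (0 : R) < n%:R by rewrite ltr0n (leq_trans _ bn).
    rewrite -EFinD lee_fin close_freqE mulrC ler_pdivrMr//.
    apply: (@le_trans _ _ n.+1%:R); first by rewrite ler_nat close_count_le.
    rewrite -natr1 mulrDl mul1r lerD2l -ler_pdivrMl// mulr1.
    rewrite (le_trans (ltW (archi_boundP _)))//; first by rewrite invr_ge0 ltW.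
    by rewrite ler_nat ltnW.
  apply/lee_subgt0Pr => e e0; apply: limn_esup_ge => n0.
  pose j := maxn n0 (maxn (Num.bound delta^-1) (Num.bound e^-1)).
  have jd : j.+1%:R^-1 < delta.
    rewrite -[ltRHS]invrK ltf_pV2 ?posrE ?invr_gt0 ?ltr0n//.
    apply: lt_le_trans (archi_boundP _) _; first by rewrite invr_ge0 ltW.
    by rewrite ler_nat leqW// !leq_max leqnn orbT.
  have je : 1 <= e * j.+2%:R.
    rewrite -ler_pdivrMl// mulr1 (le_trans (ltW (archi_boundP _)))//.
      by rewrite invr_ge0 ltW.
    by rewrite ler_nat 2?leqW// !leq_max leqnn !orbT.
  have [sj [m0 _]] := sm j; set b := (s j + m j)%N in sj.
  have b0 : (0 < b)%N by rewrite /b addn_gt0 m0 orbT.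
  have nj : (n0 <= j)%N by rewrite leq_max leqnn.
  (* At this index exactly the times below [s j.+1] are counted. *)
  exists (s j.+1).-1; first by rewrite sj; nia.
  have s0 : (s j.+1).-1.+1 = s j.+1 by rewrite prednK// sj muln_gt0.
  have p0 : (0 : R) < (s j.+1).-1%:R by rewrite ltr0n sj; nia.
  rewrite -EFinB lee_fin close_freqE s0 mulrC ler_pdivlMr//.
  have cc : (s j.+1 - b <= close_count delta (s j.+1))%N.
    by apply: close_count_block => t tb; apply: le_lt_trans jd; exact: close.
  have : (j.+1 * b)%:R <= (close_count delta (s j.+1))%:R :> R.
    by rewrite ler_nat; apply: leq_trans cc; rewrite sj; nia.
  apply: le_trans.
  have -> : (s j.+1).-1%:R = j.+2%:R * b%:R - 1 :> R.
    by rewrite -natrM -sj -[in RHS]s0 -natr1 addrK.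
  rewrite natrM -[in X in _ <= X * _](addrK 1 j.+1%:R) natr1.
  have b1 : (1 : R) <= b%:R by rewrite ler1n.
  have j2 : (1 : R) <= j.+2%:R by rewrite ler1n.
  nra.
exists kappa.
  rewrite k0/=; have [i _ fi] := far 0%N; have [_ [m0 _]] := sm i.
  have : 0 < far_count f kappa (s i) (m i) x y.
    by apply: lt_le_trans fi; rewrite mulr_gt0// ltr0n.
  rewrite leNgt => f0; apply/negP => dk; move: f0; rewrite /far_count big1 ?ltxx// => k _.
  apply/eqP; rewrite pnatr_eq0 eqb0 -ltNge; apply: le_lt_trans dk.
  exact: mdist_le_diam.
(* At least [gamma / 2] of the times up to the end of a good free block are far; half of this
   absorbs the division by [b - 1] instead of [b], once [gamma * b >= 4]. *)
apply: (@le_lt_trans _ _ (1 - gamma / 4)%:E); last by rewrite lte_fin gtrBl divr_gt0.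
apply: limn_einf_le => n0.
have [i iN fi] := far (maxn n0 (Num.bound (4 / gamma))).
have [_ [m0 smi]] := sm i; set b := (s i + m i)%N.
have bi : (i < b)%N by have := s_ge i; rewrite /b; lia.
exists b.-1; first by move: iN; rewrite geq_max; lia.
have b1 : b.-1.+1 = b by rewrite prednK//; lia.
have i0 : (0 < i)%N.
  move: iN; rewrite geq_max => /andP[_]; apply: leq_trans.
  by rewrite -(ltr_nat R); apply: lt_trans (archi_boundP _); rewrite ?divr_gt0// ltW// divr_gt0.
have p0 : (0 : R) < b.-1%:R by rewrite ltr0n; lia.
rewrite lee_fin close_freqE b1 mulrC ler_pdivrMr//.
have h1 := close_count_far kappa (s i) (m i); rewrite -/b in h1.
have -> : b.-1%:R = b%:R - 1 :> R by rewrite -[in RHS]b1 -natr1 addrK.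
have h2 : 4 <= gamma * b%:R.
  rewrite -ler_pdivrMl// mulrC (le_trans (ltW (archi_boundP _)))//.
    by rewrite divr_ge0// ltW.
  by rewrite ler_nat (leq_trans _ (ltnW bi))// (leq_trans _ iN)// leq_max leqnn orbT.
have h3 : b%:R <= 2 * (m i)%:R :> R.
  by rewrite -natrM ler_nat /b; lia.
nra.
Qed.

End FarClosePair.

(** * Separated sets and the conclusion on topological entropy *)

Section Entropy.
Context {R : realType} {X : metricType R} (f : X -> X).

Lemma bowen_dist_gt n (eps : R) (x y : X) : 0 <= eps -> eps < bowen_dist f n x y ->
  exists2 k, (k < n)%N & eps < mdist (iter k f x) (iter k f y).
Proof.
move=> e0; apply: contraPP => /forall2NP no; apply/negP; rewrite -leNgt.
apply: bigmax_le => // k _; rewrite leNgt; apply/negP => lt.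
by have [] := no k.
Qed.

Lemma max_separated_ge1 n (eps : R) : [set: X] !=set0 -> (1 <= max_separated f n eps)%E.
Proof.
move=> [x _]; apply: ereal_sup_ubound; exists [fset x]%fset; last by rewrite cardfs1.
by move=> a b; rewrite !inE => /eqP -> /eqP ->.
Qed.

Lemma separated_growth_gt (eps h : R) : [set: X] !=set0 -> 0 < h ->
  (h%:E < separated_growth f eps)%E ->
  forall n0, exists n (D : {fset X}), [/\ (n0 < n)%N, bowen_separated f n eps D &
    n%:R * h < ln #|` D|%:R].
Proof.
move=> X0 h0 hg n0.
have [n [nn]] : exists n, (n0 < n)%N /\ (h%:E < (n%:R^-1)%:E * lne (max_separated f n eps))%E.
  apply/not_existsP => no; move: hg; apply/negP; rewrite -leNgt; apply: limn_esup_le.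
  exists n0.+1 => n nn; rewrite leNgt; apply/negP => lt.
  by apply: (no n).
have n_gt0 : 0 < n%:R :> R by rewrite ltr0n (leq_ltn_trans _ nn).
rewrite lte_pdivlMl// -EFinM => hn.
have : ((expR (n%:R * h))%:E < max_separated f n eps)%E.
  have M1 := max_separated_ge1 n eps X0.
  rewrite ltNge; apply/negP => le; move: hn; apply/negP; rewrite -leNgt.
  rewrite -[leRHS]/((n%:R * h)%:E) -(expRK (n%:R * h)) -lne_EFin ?expR_gt0//.
  rewrite lee_lne// in_itv/= ?lee_fin ?expR_ge0 ?leey//.
  by rewrite (le_trans _ M1).
move=> /ereal_sup_gt[_ [D sD <-]]; rewrite lte_fin => hD; exists n, D; split => //.
by rewrite -(expRK (n%:R * h)) ltr_ln ?posrE ?expR_gt0// (lt_trans _ hD) ?expR_gt0.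
Qed.

Lemma separated_growth_ge0 (eps : R) : [set: X] !=set0 -> (0 <= separated_growth f eps)%E.
Proof.
move=> X0; apply: limn_esup_ge => n; exists n => //.
by apply: mule_ge0; rewrite ?lee_fin ?invr_ge0// lne_ge0 max_separated_ge1.
Qed.

Lemma separated_growth_DC2 (eps h : R) : tds f -> 0 < eps -> 0 < h ->
  (h%:E < separated_growth f eps)%E -> exists x y, DC2_pair f x y.
Proof.
move=> [X0 cX cf] e0 h0 hg.
have [N hN] := choice (separated_growth_gt X0 h0 hg).
have [D hD] := choice hN.
have [U [UU ooU]] := ultraFilterLemma (@eventually_filter).
have [] := @exists_far_close_pair R X f cf cX U UU ooU D N eps h.
- move=> i; have [_ _ lD] := hD i; rewrite lt0n; apply/eqP => D0.
  move: lD; rewrite D0 ln0// ltNge => /negP; apply.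
  by rewrite mulr_ge0// ltW.
- by move=> i; have [] := hD i.
- exact: e0.
- exact: h0.
- by move=> i; exact: fset_uniq.
- move=> i a b aD bD ab; have [_ sD _] := hD i.
  by apply: bowen_dist_gt; [exact: ltW|exact: sD].
- by move=> i; have [_ _ /ltW] := hD i.
move=> x [y [g [k [s [m [g0 k0 sm close far]]]]]].
by exists x, y; exact: far_close_pair_DC2 far.
Qed.

End Entropy.

Theorem mainTheorem7 (R : realType) (X : metricType R) (f : X -> X)
    (f_tds : tds f) (f_DC : strictly_DC2half f) :
  topological_entropy f = 0%E.
Proof.
have [X0 _ _] := f_tds.
(* The growth rate already vanishes at each fixed scale [eps > 0]. *)
apply: lim_near_cst => //; near=> eps.
have e0 : 0 < eps by near: eps; exact: nbhs_right_gt.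
apply/eqP; rewrite eq_le separated_growth_ge0// andbT.
apply/lee_addgt0Pr => h h0; rewrite add0e leNgt; apply/negP => hg.
have [x [y xy]] := separated_growth_DC2 f_tds e0 h0 hg.
by case: f_DC => _ /(_ x y).
Unshelve. all: by end_near. Qed.
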